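(* There is an absolute constant $C>0$ such that every finite integer matrix $A$ with $\|A\|_{\gamma_2}\le\gamma$ can be written $$A=\sum_{i=1}^{L}\sigma_iB_i,\qquad L\le 2^{C\gamma^4},$$ where each $B_i$ is blocky and $\sigma_i\in\{-1,1\}$. In particular this applies to every Boolean (that is, $0/1$-valued) finite matrix of Schur-multiplier norm at most $\gamma$.
   Context: Blocky matrix: a $0/1$ matrix $B$ with rows indexed by $X$ and columns indexed by $Y$ is blocky if, after independently permuting its rows and its columns, it becomes a block-diagonal matrix each of whose blocks is entirely $1$s, together with some all-zero rows and columns. Equivalently, there are pairwise disjoint subsets $X_\lambda\subseteq X$ and pairwise disjoint subsets $Y_\lambda\subseteq Y$ indexed by a common label set such that the support of $B$ is $\bigcup_\lambda X_\lambda\times Y_\lambda$. Factorization norm: for a real matrix $A:X\times Y\to\mathbb{R}$, $$\|A\|_{\gamma_2}:=\inf\Big\{\big(\sup_x\|u_x\|\big)\big(\sup_y\|v_y\|\big):A(x,y)=\langle u_x,v_y\rangle\text{ for some Hilbert space vectors }u_x,v_y\Big\}.$$ For finite matrices, $\|\cdot\|_{\gamma_2}$ coincides with the Schur-multiplier norm, i.e. the operator norm of the entrywise multiplication map $B\mapsto A\circ B$ on matrices equipped with the $\ell_2\to\ell_2$ operator norm. *)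

(* Defs.v *)
From HB Require Import structures.
From mathcomp Require Import all_boot all_order all_algebra.
From mathcomp Require Import all_classical all_reals all_analysis.

Set Implicit Arguments.
Unset Strict Implicit.
Unset Printing Implicit Defensive.

Import Order.TTheory GRing.Theory Num.Theory numFieldNormedType.Exports.
Local Open Scope classical_set_scope.
Local Open Scope ring_scope.

Definition boolean_mx (m n : nat) (A : 'M[int]_(m, n)) : Prop :=
  forall i j, A i j = 0 \/ A i j = 1.

Definition blocky (m n : nat) (B : 'M[int]_(m, n)) : Prop :=
  boolean_mx B /\
  exists (Lam : finType) (X : Lam -> {set 'I_m}) (Y : Lam -> {set 'I_n}),
    [/\ forall l l', l != l' -> (X l :&: X l' = finset.set0)%SET,
        forall l l', l != l' -> (Y l :&: Y l' = finset.set0)%SET &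
        forall i j, B i j != 0 <-> exists l, i \in X l /\ j \in Y l].

(* A real Hilbert space is a complete normed space [V] together with a
   symmetric positive definite bilinear form [dot] inducing its norm. *)
Definition hilbert_dot (R : realType) (V : completeNormedModType R)
    (dot : {dot V for idfun}) : Prop :=
  forall v : V, `|v| ^+ 2 = dot v v.

(* [r] is the value (sup_x |u_x|) (sup_y |v_y|) of a Hilbert space
   factorization of [A]. If [A] has no rows or no columns, the corresponding
   supremum is [sup set0 = 0]. *)
Definition factorization_value (R : realType) (m n : nat) (A : 'M[R]_(m, n))
    (r : R) : Prop :=
  exists (V : completeNormedModType R) (dot : {dot V for idfun})
         (u : 'I_m -> V) (v : 'I_n -> V),
    [/\ hilbert_dot dot,
        forall x y, A x y = dot (u x) (v y) &
        r = sup (range (fun x => `|u x|)) * sup (range (fun y => `|v y|))].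

Definition gamma2 (R : realType) (m n : nat) (A : 'M[R]_(m, n)) : \bar R :=
  ereal_inf [set r%:E | r in [set r : R | factorization_value A r]].

Definition l2norm (R : realType) (n : nat) (x : 'cV[R]_n) : R :=
  Num.sqrt (\sum_i x i 0 ^+ 2).

Definition l2_opnorm (R : realType) (m n : nat) (B : 'M[R]_(m, n)) : \bar R :=
  ereal_sup [set (l2norm (B *m x))%:E | x in [set x | l2norm x <= 1]].

Definition schur_norm (R : realType) (m n : nat) (A : 'M[R]_(m, n)) : \bar R :=
  ereal_sup [set l2_opnorm (map2_mx *%R A B)
            | B in [set B : 'M[R]_(m, n) | (l2_opnorm B <= 1%:E)%E]].

Definition int_to_real_mx (R : realType) (m n : nat) (A : 'M[int]_(m, n)) :
  'M[R]_(m, n) := map_mx intr A.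

Definition signed_blocky_sum (m n : nat) (A : 'M[int]_(m, n)) (L : nat) : Prop :=
  exists (sigma : 'I_L -> int) (B : 'I_L -> 'M[int]_(m, n)),
    [/\ forall i, sigma i = -1 \/ sigma i = 1,
        forall i, blocky (B i) &
        A = \sum_(i < L) sigma i *: B i].

(* Main.v *)
(** Let [A x y] be close to [<u x, v y>]. If some column [y] meets many pairwise
distinct rows that are nonzero at [y], then among these rows there is a set [T],
with at least two elements, on which every column is constant up to a tiny
proportion of exceptions: otherwise these rows could be split repeatedly into two
large parts separated by a column, and the midpoint of points in the convex hulls of
the two parts would get shorter by a fixed amount each time. The mean [c] of [u]
over such a [T] is then close to an integer row [al], and some [x] in [T] satisfies
[<u x, c> >= |c|^2], so that both [c] and [u x - c] are shorter than [u x] by a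
fixed amount. Subtracting [al] from row [x] thus splits it into two rows of smaller
norm. Once this is impossible for all rows, and likewise for all columns, every
column meets boundedly many distinct nonzero rows and conversely, and such a matrix
is a bounded signed sum of blocky ones. The norms can only decrease [O(gamma^2)]
times, each split multiplies the error of the approximation by a constant, so the
tolerance is [2^(-O(gamma^2))] and the final degree bound is [2^(O(gamma^4))].

A Schur multiplier bound gives an approximate factorization by nearly minimizing the
distance from [A] to [F H^T] plus the squared excess over [gamma] of the squared row
norms of [F] and [H]: stationarity under scaling and under adding a rank one term
produces the test matrix for the Schur multiplier norm. *)
Require Import Defs.
From mathcomp Require Import all_boot all_order all_algebra.
From mathcomp Require Import all_classical all_reals all_analysis.
From mathcomp Require Import zify ring lra.
Set Implicit Arguments.
Unset Strict Implicit.
Unset Printing Implicit Defensive.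
Import Order.TTheory GRing.Theory Num.Theory.
Local Open Scope ring_scope.

(** * Blocky sums and matrices with few distinct nonzero rows *)

(** Under the rectangle condition two rows whose supports meet have the same support, so the
    nonempty row supports can label the blocks. *)
Lemma blocky_rect m n (B : 'M[int]_(m, n)) : boolean_mx B ->
  (forall x x' y y', B x y != 0 -> B x' y != 0 -> B x' y' != 0 -> B x y' != 0) ->
  blocky B.
Proof.
move=> boolB rectB; split=> //.
pose supp x := [set y | B x y != 0]%SET.
(* The column block of a label is emptied unless the label is the support of some row; this is what
   makes column blocks disjoint. *)
exists {set 'I_n}, (fun l => [set x | (supp x == l) && (l != finset.set0)]%SET),
  (fun l : {set 'I_n} => [set y in l | [exists x, supp x == l]]%SET); split.
- move=> l l' neq; apply/setP=> x; rewrite !inE.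
  by apply/negP=> /andP[/andP[/eqP e _] /andP[/eqP e' _]]; rewrite -e -e' eqxx in neq.
- move=> l l' neq; apply/setP=> y; rewrite !inE.
  apply/negP=> /andP[/andP[yl /existsP[x /eqP xl]] /andP[yl' /existsP[x' /eqP xl']]].
  case/negP: neq; subst l l'; move: yl yl'; rewrite !inE => yl yl'.
  apply/eqP/setP=> z; rewrite !inE; apply/idP/idP => h.
    exact: (rectB x' x y z).
  exact: (rectB x x' y z).
- move=> x y; split=> [nz|[l]].
    exists (supp x); rewrite !inE eqxx nz /=; split; last by apply/existsP; exists x.
    by apply/set0Pn; exists y; rewrite inE.
  by rewrite !inE => -[/andP[/eqP <- _] /andP[]]; rewrite inE.
Qed.

Lemma blocky_tr m n (B : 'M[int]_(m, n)) : blocky B -> blocky B^T.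
Proof.
case=> boolB [Lam [X [Y [dX dY suppB]]]]; split; first by move=> i j; rewrite mxE.
exists Lam, Y, X; split=> // i j; rewrite mxE (suppB j i).
by split=> -[l []]; exists l.
Qed.

(** Signs are absorbed into the summands and [L] is only an upper bound, so sums, negation and
    transposition act directly on the list. *)
Definition signed_blocky_le m n (A : 'M[int]_(m, n)) (L : nat) : Prop :=
  exists s : seq 'M[int]_(m, n),
    [/\ (size s <= L)%N,
        forall B, B \in s -> blocky B \/ blocky (- B) &
        A = \sum_(B <- s) B].

Lemma signed_blocky_le_sum m n (A : 'M[int]_(m, n)) L :
  signed_blocky_le A L -> exists2 L', (L' <= L)%N & signed_blocky_sum A L'.
Proof.
move=> [s [sz blk ->]]; exists (size s) => //.
have mem (i : 'I_(size s)) : s`_i \in s by rewrite mem_nth.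
pose sg (i : 'I_(size s)) : int := if `[< blocky s`_i >] then 1 else -1.
exists sg, (fun i => sg i *: s`_i); split.
- by move=> i; rewrite /sg; case: ifP; [right|left].
- move=> i; rewrite /sg; case: ifP => [/asboolP|/asboolP nb]; first by rewrite scale1r.
  by rewrite scaleN1r; case: (blk _ (mem i)).
- rewrite (big_nth 0) big_mkord; apply: eq_bigr => i _.
  by rewrite scalerA /sg; case: ifP => _; rewrite ?mulr1 ?mulrNN ?mulr1 scale1r.
Qed.

Lemma signed_blocky_le0 m n L : signed_blocky_le (0 : 'M[int]_(m, n)) L.
Proof. by exists [::]; split=> //; rewrite big_nil. Qed.

Lemma signed_blocky_leW m n (A : 'M[int]_(m, n)) L L' :
  (L <= L')%N -> signed_blocky_le A L -> signed_blocky_le A L'.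
Proof. by move=> le [s [sz blk ->]]; exists s; split=> //; apply: leq_trans le. Qed.

Lemma signed_blocky_leD m n (A B : 'M[int]_(m, n)) L L' :
  signed_blocky_le A L -> signed_blocky_le B L' ->
  signed_blocky_le (A + B) (L + L').
Proof.
move=> [s [sz blk ->]] [s' [sz' blk' ->]]; exists (s ++ s'); split.
- by rewrite size_cat leq_add.
- by move=> C; rewrite mem_cat => /orP[/blk|/blk'].
- by rewrite big_cat.
Qed.

Lemma signed_blocky_le_bigsum m n (I : finType) (F : I -> 'M[int]_(m, n)) L :
  (forall i, signed_blocky_le (F i) L) ->
  signed_blocky_le (\sum_i F i) (#|I| * L).
Proof.
move=> hF; rewrite cardE -big_enum /=; elim: (enum I) => [|i s IH].
  by rewrite big_nil; apply: signed_blocky_le0.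
by rewrite big_cons /= mulSn; apply: signed_blocky_leD.
Qed.

Lemma signed_blocky_leN m n (A : 'M[int]_(m, n)) L :
  signed_blocky_le A L -> signed_blocky_le (- A) L.
Proof.
move=> [s [sz blk ->]]; exists (map -%R s); split.
- by rewrite size_map.
- by move=> _ /mapP[B /blk + ->]; rewrite opprK; case; [right|left].
- by rewrite big_map sumrN.
Qed.

Lemma signed_blocky_le_tr m n (A : 'M[int]_(m, n)) L :
  signed_blocky_le A L -> signed_blocky_le A^T L.
Proof.
move=> [s [sz blk ->]]; exists [seq B^T | B <- s]; split.
- by rewrite size_map.
- move=> _ /mapP[B /blk + ->]; case=> /blocky_tr; first by left.
  by rewrite linearN; right.
- by rewrite big_map linear_sum.
Qed.

Lemma signed_blocky_le1 m n (A : 'M[int]_(m, n)) : blocky A -> signed_blocky_le A 1.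
Proof.
move=> blkA; exists [:: A]; split=> //; last by rewrite big_seq1.
by move=> B; rewrite inE => /eqP ->; left.
Qed.

(** The degree bound of the argument: rows are counted up to repetition, because equal rows can
    share a block. *)
Definition row_sparse (K m n : nat) (A : 'M[int]_(m, n)) : Prop :=
  forall (y : 'I_n) (S : {set 'I_m}), {in S, forall x, A x y != 0} ->
    {in S &, injective (fun x => row x A)} -> (#|S| <= K)%N.

(** * Numbering the distinct rows that meet a column *)

Section RowRank.
Context {m n : nat} (A : 'M[int]_(m, n)).

(** A canonical representative of a class of equal rows; the default is never reached, since [x]
    itself passes the test. *)
Definition row_rep (x : 'I_m) : 'I_m := odflt x [pick z | row z A == row x A].

Lemma row_repE x : row (row_rep x) A = row x A.
Proof. by rewrite /row_rep; case: pickP => [z /eqP|]. Qed.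

Lemma row_rep_eq x z : row x A = row z A -> row_rep x = row_rep z.
Proof.
move=> e; rewrite /row_rep (eq_pick (Q := fun w => row w A == row z A)); last first.
  by move=> w; rewrite e.
by case: pickP => // /(_ z); rewrite eqxx.
Qed.

Definition rep_support (y : 'I_n) : {set 'I_m} :=
  [set x | (A x y != 0) && (row_rep x == x)]%SET.

Lemma eq_row_entry x z y : row x A = row z A -> A x y = A z y.
Proof. by move=> /rowP /(_ y); rewrite !mxE. Qed.

Lemma rep_in_support x y : A x y != 0 -> row_rep x \in rep_support y.
Proof.
move=> nz; rewrite inE (eq_row_entry _ (row_repE x)) nz /=.
by rewrite (row_rep_eq (row_repE x)).
Qed.

Definition row_rank x y : nat := index (row_rep x) (enum (rep_support y)).

Lemma row_rank_lt K x y : row_sparse K A -> A x y != 0 -> (row_rank x y < K)%N.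
Proof.
move=> sparse nz; apply: (@leq_trans #|rep_support y|).
  by rewrite cardE index_mem mem_enum rep_in_support.
apply: (sparse y) => [z|z w]; first by rewrite inE => /andP[].
rewrite !inE => /andP[_ /eqP ez] /andP[_ /eqP ew] /row_rep_eq.
by rewrite ez ew.
Qed.

Lemma row_rank_inj x z y : A x y != 0 -> row_rank x y = row_rank z y ->
  row x A = row z A.
Proof.
move=> nz e; rewrite -row_repE -(row_repE z); congr (row _ A).
have xin : row_rep x \in enum (rep_support y) by rewrite mem_enum rep_in_support.
(* The common rank is smaller than the length of the list, so the representative of [z] is in the
   list as well. *)
have zin : row_rep z \in enum (rep_support y).
  by rewrite -index_mem -/(row_rank z y) -e index_mem.
by rewrite -(nth_index x xin) -/(row_rank x y) e /row_rank nth_index.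
Qed.

Lemma eq_row_rank x z y : row x A = row z A -> row_rank x y = row_rank z y.
Proof. by move=> /row_rep_eq; rewrite /row_rank => ->. Qed.

Lemma row_rank_col x y z : (forall w, A w y = A w z) -> row_rank x y = row_rank x z.
Proof.
move=> e; rewrite /row_rank; suff -> : rep_support y = rep_support z by [].
by apply/setP=> w; rewrite !inE e.
Qed.

End RowRank.

Lemma eq_row_tr m n (A : 'M[int]_(m, n)) y z :
  row y A^T = row z A^T -> forall w, A w y = A w z.
Proof. by move=> e w; have := eq_row_entry w e; rewrite !mxE. Qed.

Lemma sum_ltn_ord (k M : nat) : (\sum_(t < M) (t < k) = minn k M)%N.
Proof.
elim: M => [|M IH]; first by rewrite big_ord0 minn0.
by rewrite big_ord_recr /= IH; lia.
Qed.

Section Pieces.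
Context {m n : nat} (A : 'M[int]_(m, n)).

(* Rows nonzero at [y] with the same rank at [y] are equal, and similarly for
   columns, so a nonzero entry of a piece determines its row and its column up to
   repetition. *)
Definition piece (t i j : nat) : 'M[int]_(m, n) :=
  \matrix_(x, y) (((t%:Z < A x y) && (row_rank A x y == i)
                  && (row_rank A^T y x == j))%:R).

Lemma piece_blocky t i j : blocky (piece t i j).
Proof.
apply: blocky_rect => [x y|x x' y y'].
  by rewrite mxE; case: (X in nat_of_bool X); [right|left].
have nzb (b : bool) : (b%:R != 0 :> int) = b by case: b.
rewrite !mxE !nzb => /andP[/andP[h1 /eqP r1] /eqP s1].
move=> /andP[/andP[h2 /eqP r2] /eqP s2] /andP[/andP[h3 /eqP r3] /eqP s3].
have nz (a : int) : t%:Z < a -> a != 0.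
  by move=> ?; rewrite gt_eqF //; lia.
have exx' : row x A = row x' A by apply: (row_rank_inj (nz _ h1)); rewrite r1.
have nzT : A^T y x' != 0 by rewrite mxE nz.
have eyy' : row y A^T = row y' A^T by apply: (row_rank_inj nzT); rewrite s2.
rewrite (eq_row_entry _ exx') h3 (eq_row_rank _ exx') r3 eqxx /=.
rewrite -(eq_row_rank _ eyy') (@row_rank_col _ _ A^T y x x') ?s2 //.
by move=> w; rewrite !mxE (eq_row_entry _ exx').
Qed.

(** Layer-cake decomposition: each level [t] below [A x y] is counted once, by the pair of ranks of
    the entry, and sparsity keeps both ranks below [K]. *)
Lemma piece_sum (K M : nat) x y : row_sparse K A -> row_sparse K A^T ->
  A x y <= M%:Z ->
  \sum_(p : 'I_M * ('I_K * 'I_K)) piece p.1 p.2.1 p.2.2 x y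
    = Num.max 0 (A x y).
Proof.
move=> sr sc bound.
rewrite -(pair_bigA _ (fun (t : 'I_M) (p : 'I_K * 'I_K) => piece t p.1 p.2 x y)) /=.
transitivity (\sum_(t < M) ((t%:Z < A x y)%R%:R : int)).
  apply: eq_bigr => t _.
  rewrite -(pair_bigA _ (fun i j : 'I_K => piece t i j x y)) /=.
  have [lt_t|] := boolP (t%:Z < A x y); last first.
    by move=> /negbTE h; rewrite big1 // => i _; rewrite big1 // => j _; rewrite mxE h.
  have nz : A x y != 0 by rewrite gt_eqF //; lia.
  have nzT : A^T y x != 0 by rewrite mxE.
  rewrite (bigD1 (Ordinal (row_rank_lt sr nz))) //= [X in _ + X]big1 ?addr0; last first.
    move=> i ne; rewrite big1 // => j _; rewrite mxE.
    case: (row_rank A x y =P i) => [e|]; last by rewrite andbF.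
    by case/eqP: ne; apply: val_inj.
  rewrite (bigD1 (Ordinal (row_rank_lt sc nzT))) //= [X in _ + X]big1 ?addr0; last first.
    move=> i ne; rewrite mxE.
    case: (row_rank A^T y x =P i) => [e|]; last by rewrite andbF.
    by case/eqP: ne; apply: val_inj.
  by rewrite mxE lt_t !eqxx.
transitivity ((\sum_(t < M) (t < `|Num.max 0%R (A x y)|))%N%:R : int).
  rewrite natr_sum; apply: eq_bigr => t _; congr ((nat_of_bool _)%:R); lia.
rewrite sum_ltn_ord; set k := Num.max 0 (A x y).
have -> : minn `|k|%N M = `|k|%N by apply/minn_idPl; rewrite /k; lia.
by rewrite -[RHS]gez0_abs ?natz // /k; lia.
Qed.

End Pieces.

Lemma sparse_signed_blocky K M m n (A : 'M[int]_(m, n)) :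
  row_sparse K A -> row_sparse K A^T -> (forall x y, `|A x y| <= M%:Z) ->
  signed_blocky_le A (2 * (M * K ^ 2)).
Proof.
move=> sr sc bound.
have pos (B : 'M[int]_(m, n)) : signed_blocky_le
    (\sum_(p : 'I_M * ('I_K * 'I_K)) piece B p.1 p.2.1 p.2.2) (M * K ^ 2).
  have -> : (M * K ^ 2 = #|{: 'I_M * ('I_K * 'I_K)}| * 1)%N.
    by rewrite !card_prod !card_ord muln1.
  by apply: signed_blocky_le_bigsum => p; apply/signed_blocky_le1/piece_blocky.
rewrite mul2n -addnn.
(* The negative part of [A] is the positive part of [- A]. *)
suff -> : A = \sum_(p : 'I_M * ('I_K * 'I_K)) piece A p.1 p.2.1 p.2.2
            + - \sum_(p : 'I_M * ('I_K * 'I_K)) piece (- A) p.1 p.2.1 p.2.2.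
  by apply: signed_blocky_leD => //; apply: signed_blocky_leN.
have srN k l (B : 'M[int]_(k, l)) : row_sparse K B -> row_sparse K (- B).
  move=> sp y S nz inj; apply: (sp y) => [x xS|x z xS zS e].
    by have := nz x xS; rewrite mxE oppr_eq0.
  apply: inj => //; apply/rowP=> j; rewrite !mxE; congr (- _).
  exact: eq_row_entry.
apply/matrixP=> x y; rewrite !mxE !summxE (piece_sum sr sc); last by have := bound x y; lia.
have bN : (- A) x y <= M%:Z.
  by rewrite mxE (le_trans (ler_norm _)) // normrN bound.
have scN : row_sparse K (- A)^T by rewrite linearN; apply: srN.
rewrite (piece_sum (srN _ _ _ sr) scN bN) mxE.
have maxN (a : int) : a = Num.max 0 a - Num.max 0 (- a) by lia.
exact: maxN.
Qed.

(** * Reducible rows *)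

(** A common interface for the Hilbert spaces behind [gamma2] and the finite-dimensional
    factorizations extracted from [schur_norm]. *)
Definition psd_form (R : realType) (V : lmodType R) (dot : V -> V -> R) : Prop :=
  [/\ forall u v, dot u v = dot v u,
      forall u v w, dot (u + v) w = dot u w + dot v w,
      forall a u v, dot (a *: u) v = a * dot u v &
      forall u, 0 <= dot u u].

Section PsdForm.
Context {R : realType} {V : lmodType R} {dot : V -> V -> R}.
Hypothesis psd : psd_form dot.

Let dotC u v : dot u v = dot v u. Proof. by case: psd. Qed.
Let dotDl u v w : dot (u + v) w = dot u w + dot v w. Proof. by case: psd. Qed.
Let dotZl a u v : dot (a *: u) v = a * dot u v. Proof. by case: psd. Qed.
Let dot_ge0 u : 0 <= dot u u. Proof. by case: psd. Qed.
Let dotDr u v w : dot u (v + w) = dot u v + dot u w.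
Proof. by rewrite dotC dotDl !(dotC u). Qed.
Let dotZr a u v : dot u (a *: v) = a * dot u v.
Proof. by rewrite dotC dotZl dotC. Qed.
Let dotNl u v : dot (- u) v = - dot u v.
Proof. by rewrite -scaleN1r dotZl mulN1r. Qed.
Let dotNr u v : dot u (- v) = - dot u v.
Proof. by rewrite dotC dotNl dotC. Qed.

Lemma psd0l v : dot 0 v = 0. Proof. by rewrite -(scale0r 0) dotZl mul0r. Qed.
Lemma psd0r v : dot v 0 = 0. Proof. by rewrite dotC psd0l. Qed.

Lemma psd_suml (I : finType) (P : pred I) (F : I -> V) w :
  dot (\sum_(i | P i) F i) w = \sum_(i | P i) dot (F i) w.
Proof. by apply: (big_morph (dot^~ w)) => [u v|]; rewrite ?dotDl ?psd0l. Qed.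

Lemma psd_normB u v : dot (u - v) (u - v) = dot u u - 2 * dot u v + dot v v.
Proof. by rewrite dotDl !dotDr !dotNl !dotNr (dotC v u); ring. Qed.

Lemma psd_normD u v : dot (u + v) (u + v) = dot u u + 2 * dot u v + dot v v.
Proof. by rewrite dotDl !dotDr (dotC v u); ring. Qed.

Lemma psd_CauchySchwarz u v : dot u v ^+ 2 <= dot u u * dot v v.
Proof.
have key t : 0 <= dot u u - 2 * t * dot u v + t ^+ 2 * dot v v.
  by have := dot_ge0 (u - t *: v); rewrite psd_normB !dotZr dotZl; nra.
have := dot_ge0 v; rewrite le_eqVlt => /orP[/eqP v0|vgt0].
  have [->|ne] := eqVneq (dot u v) 0; first by rewrite -v0 mulr0 expr0n.
  (* The quadratic in [t] has become affine, and this value of [t] makes it equal to [-1]. *)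
  have := key ((dot u u + 1) / (2 * dot u v)).
  have -> : 2 * ((dot u u + 1) / (2 * dot u v)) * dot u v = dot u u + 1 by field.
  by rewrite -v0 mulr0 addr0 => h; exfalso; lra.
have := key (dot u v / dot v v).
have -> : dot u u - 2 * (dot u v / dot v v) * dot u v + (dot u v / dot v v) ^+ 2 * dot v v
   = (dot u u * dot v v - dot u v ^+ 2) / dot v v by field; rewrite gt_eqF.
by rewrite pmulr_lge0 ?invr_gt0 // subr_ge0.
Qed.

Lemma psd_norm_bound G u v : dot u u <= G -> dot v v <= G -> `|dot u v| <= G.
Proof.
move=> hu hv; have G0 : 0 <= G by apply: le_trans hu.
rewrite -(@ler_pXn2r _ 2) ?nnegrE // real_normK ?num_real //.
apply: le_trans (psd_CauchySchwarz u v) _.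
by rewrite expr2 ler_pM.
Qed.

(** Applied mostly to differences of vectors, this turns a gap between matrix entries into a
    distance. *)
Lemma psd_separated s b u v : 0 <= s -> s <= `|dot u v| -> dot v v <= b ->
  s ^+ 2 <= dot u u * b.
Proof.
move=> s0 h hv; apply: (@le_trans _ _ (dot u v ^+ 2)).
  by rewrite -(real_normK (num_real (dot u v))) ler_pXn2r ?nnegrE.
by apply: le_trans (psd_CauchySchwarz u v) _; rewrite ler_wpM2l.
Qed.

(** * Hulls and means of row vectors *)

Section Rows.
Context {m n : nat}.
Implicit Types (T S : {set 'I_m}) (A : 'M[int]_(m, n)) (u : 'I_m -> V).

(** The convex hull described by half-spaces: every linear lower bound valid on the points holds at
    [c]. No convex coefficients have to be carried along. *)
Definition in_hull u T (c : V) : Prop :=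
  forall w t, (forall x, x \in T -> t <= dot (u x) w) -> t <= dot c w.

Lemma in_hull_midpoint u T T1 T2 c1 c2 : T1 \subset T -> T2 \subset T ->
  in_hull u T1 c1 -> in_hull u T2 c2 -> in_hull u T (2^-1 *: (c1 + c2)).
Proof.
move=> /fintype.subsetP s1 /fintype.subsetP s2 h1 h2 w t hT.
have := h1 w t (fun x xT => hT x (s1 x xT)).
have := h2 w t (fun x xT => hT x (s2 x xT)).
by rewrite dotZl dotDl; lra.
Qed.

Definition mostly_constant A (N : nat) T : Prop :=
  forall y, exists a : int, (#|[set x in T | A x y != a]%SET| * N <= #|T|)%N.

(** Take the least threshold [t] with at least a fraction [1 / (2 * N)] of [T] at or below it. Fewer
    rows lie strictly below [t], while more than [1 / N] of them differ from [t], so the rows above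
    [t] are numerous too. *)
Lemma not_mostly_constant_split A N T : (0 < N)%N -> (0 < #|T|)%N ->
  ~ mostly_constant A N T -> exists y t,
    (#|T| <= 2 * N * #|[set x in T | (A x y <= t)%R]%SET|)%N /\
    (#|T| <= 2 * N * #|[set x in T | (t < A x y)%R]%SET|)%N.
Proof.
move=> N0 T0 /existsNP[y /forallNP noa]; exists y.
(* Shifting by a strict bound on the entries makes thresholds natural numbers, with nothing at or
   below threshold [0]. *)
pose B : nat := (\sum_(x in T) `|A x y| + 1)%N.
have bnd x : x \in T -> (`|A x y| < B)%N.
  by move=> xT; rewrite /B (bigD1 x xT) /=; lia.
pose le k := [set x in T | (A x y <= k%:Z - B%:Z)%R]%SET.
have exP : exists k, (#|T| <= 2 * N * #|le k|)%N.
  exists (B + B)%N; have -> : le (B + B)%N = T; last by nia.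
  apply/setP=> x; rewrite inE; case xT : (x \in T) => //=.
  by have := bnd x xT; lia.
case: (ex_minnP exP) => -[|k] hk mink.
  have e0 : le 0 = finset.set0.
    apply/setP=> x; rewrite !inE; case xT : (x \in T) => //=.
    by have := bnd x xT; lia.
  by move: hk; rewrite e0 cards0; lia.
exists (k.+1%:Z - B%:Z); split => //.
pose Q := [set x in T | (k.+1%:Z - B%:Z < A x y)%R]%SET; rewrite -/Q.
have := noa (k.+1%:Z - B%:Z).
have : ~~ (#|T| <= 2 * N * #|le k|)%N by apply/negP=> /mink; lia.
have -> : [set x in T | A x y != (k.+1%:Z - B%:Z)%R]%SET =
    (le k :|: Q)%SET.
  by apply/setP=> x; rewrite !inE; case: (x \in T) => //=; lia.
rewrite cardsU (_ : _ :&: _ = finset.set0)%SET ?cards0; last first.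
  by apply/setP=> x; rewrite !inE; case: (x \in T) => //=; lia.
rewrite subn0 -ltnNge => lt_p /negP; rewrite -ltnNge mulnDl => lt_pq.
move: lt_p lt_pq; move: #|le k| #|Q| #|T| => p q r; nia.
Qed.

(* The hull points of the two sides of a split are far apart, so their midpoint is
   shorter by a fixed amount. *)
Lemma hull_descent A u (v : 'I_n -> V) (S : {set 'I_m}) (N : nat) (a G d e : R) :
  (0 < N)%N -> 0 < G -> e <= 2^-1 -> 4 * d * G <= (1 - 2 * e) ^+ 2 ->
  (forall x, dot (u x) (u x) <= a) -> (forall y, dot (v y) (v y) <= G) ->
  (forall x y, `|(A x y)%:~R - dot (u x) (v y)| <= e) ->
  (forall T, T \subset S -> (1 < #|T|)%N -> ~ mostly_constant A N T) ->
  forall k T, T \subset S -> ((2 * N) ^ k * 2 <= #|T|)%N ->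
  exists2 c, in_hull u T c & dot c c <= a - k%:R * d.
Proof.
move=> N0 G0 e2 dG hu hv happ bad; elim=> [|k IH] T TS.
  rewrite expn0 mul1n => T2; have /card_gt0P[x xT] : (0 < #|T|)%N by apply: leq_trans T2.
  exists (u x); last by rewrite mul0r subr0.
  by move=> w t; apply.
rewrite expnS => cT.
have pos : (0 < (2 * N) ^ k)%N by rewrite expn_gt0 muln_gt0 N0.
have T1 : (1 < #|T|)%N by apply: leq_trans cT; nia.
have [y [t [c1 c2]]] := not_mostly_constant_split N0 (ltnW T1) (bad T TS T1).
have big X : (#|T| <= 2 * N * #|X : {set 'I_m}|)%N -> ((2 * N) ^ k * 2 <= #|X|)%N.
  by move=> h; rewrite -(@leq_pmul2l (2 * N)) ?muln_gt0 ?N0 // mulnA (leq_trans cT).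
have sub (P : pred 'I_m) : [set x in T | P x]%SET \subset T.
  by apply/fintype.subsetP => x; rewrite inE => /andP[].
have [p1 hp1 n1] := IH _ (fintype.subset_trans (sub _) TS) (big _ c1).
have [p2 hp2 n2] := IH _ (fintype.subset_trans (sub _) TS) (big _ c2).
exists (2^-1 *: (p1 + p2)); first exact: in_hull_midpoint (sub _) (sub _) hp1 hp2.
(* [in_hull] transports lower bounds, so an upper bound is obtained by testing against [- v y]. *)
have l1 : dot p1 (v y) <= t%:~R + e.
  rewrite -lerN2 -dotNr; apply: hp1 => x; rewrite inE => /andP[_ le_t].
  rewrite dotNr lerN2; have := happ x y; rewrite ler_distl => /andP[+ _].
  by have : (A x y)%:~R <= t%:~R :> R by [rewrite ler_int|]; lra.
have l2 : t%:~R + 1 - e <= dot p2 (v y).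
  apply: hp2 => x; rewrite inE => /andP[_ lt_t].
  have := happ x y; rewrite ler_distl => /andP[_ +].
  have : (t + 1)%:~R <= (A x y)%:~R :> R by rewrite ler_int; lia.
  by rewrite intrD; lra.
have sep : (1 - 2 * e) ^+ 2 <= dot (p2 - p1) (p2 - p1) * G.
  apply: psd_separated (hv y); first by lra.
  by rewrite (le_trans _ (ler_norm _)) // dotDl dotNl; lra.
have far : 4 * d <= dot (p2 - p1) (p2 - p1).
  by rewrite -(ler_pM2r G0) (le_trans dG).
(* Parallelogram law: the midpoint loses a quarter of the squared distance between [p1] and [p2],
   which is at least [d]. *)
move: far; rewrite psd_normB !dotZl !dotZr psd_normD (dotC p2 p1) -natr1; lra.
Qed.

(** Otherwise [k] descents would give a hull point of squared norm at most [a - k%:R * d < 0]. *)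
Lemma exists_mostly_constant A u (v : 'I_n -> V) (S : {set 'I_m}) (N k : nat)
    (a G d e : R) :
  (0 < N)%N -> 0 < G -> e <= 2^-1 -> 4 * d * G <= (1 - 2 * e) ^+ 2 ->
  (forall x, dot (u x) (u x) <= a) -> (forall y, dot (v y) (v y) <= G) ->
  (forall x y, `|(A x y)%:~R - dot (u x) (v y)| <= e) ->
  a < k%:R * d -> ((2 * N) ^ k * 2 <= #|S|)%N ->
  exists T, [/\ T \subset S, (1 < #|T|)%N & mostly_constant A N T].
Proof.
move=> N0 G0 e2 dG hu hv happ ak cS; apply: contrapT => no.
have bad T : T \subset S -> (1 < #|T|)%N -> ~ mostly_constant A N T.
  by move=> TS T1 mc; apply: no; exists T.
have [c _] := hull_descent N0 G0 e2 dG hu hv happ bad (fintype.subxx S) cS.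
by have := dot_ge0 c; lra.
Qed.

Definition mean u T : V := (#|T|%:R)^-1 *: \sum_(x in T) u x.

Lemma dot_mean u T w : (0 < #|T|)%N ->
  #|T|%:R * dot (mean u T) w = \sum_(x in T) dot (u x) w.
Proof.
by move=> T0; rewrite dotZl psd_suml mulVKf // pnatr_eq0 -lt0n.
Qed.

(** An exceptional row adds at most [2 * G + 1] to the error, and at most a fraction [1 / N] of the
    rows are exceptional, so averaging adds at most [e0]. *)
Lemma mean_approx A u (v : 'I_n -> V) T (N : nat) (G e e0 : R) y al :
  0 < G -> 0 <= e -> e <= 2^-1 -> 2 * G + 1 <= e0 * N%:R ->
  (0 < #|T|)%N -> (1 < N)%N ->
  (forall x, dot (u x) (u x) <= G) -> (forall y, dot (v y) (v y) <= G) ->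
  (forall x y, `|(A x y)%:~R - dot (u x) (v y)| <= e) ->
  (#|[set x in T | A x y != al]%SET| * N <= #|T|)%N ->
  `|al%:~R - dot (mean u T) (v y)| <= e + e0.
Proof.
move=> G0 e_ge0 e2 hN T0 N1 hu hv happ few.
pose E := [set x in T | A x y != al]%SET.
have ET : E \subset T by apply/fintype.subsetP => x; rewrite inE => /andP[].
have [x0 x0T /eqP x0al] : exists2 x, x \in T & A x y == al.
  have /fintype.subsetPn[x xT] : ~~ (T \subset E).
    by apply/negP=> /subset_leq_card; rewrite -/E in few; nia.
  by rewrite inE xT /= negbK; exists x.
have dotG x : `|dot (u x) (v y)| <= G by apply: psd_norm_bound.
(* The value [al] is attained at the row [x0], hence is no larger than an entry can be. *)
have al_bound : `|al%:~R| <= G + e :> R.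
  rewrite -x0al; have := happ x0 y; have := dotG x0.
  by rewrite ler_distl !ler_norml; lra.
have term x : x \in T -> `|al%:~R - dot (u x) (v y)| <= e + (x \in E)%:R * (2 * G + 1).
  move=> xT; rewrite inE xT /=; case: eqP => [<-|_] /=; first by rewrite mul0r addr0.
  have := dotG x; move: al_bound; rewrite mul1r ler_distl !ler_norml; lra.
have T0R : 0 < #|T|%:R :> R by rewrite ltr0n.
rewrite -(ler_pM2l T0R) -{1}(gtr0_norm T0R) -normrM mulrBr dot_mean //.
rewrite mulr_natl -sumr_const -sumrB.
apply: le_trans (ler_norm_sum _ _ _) _.
apply: (@le_trans _ _ (\sum_(x in T) (e + (x \in E)%:R * (2 * G + 1)))).
  by apply: ler_sum.
rewrite big_split /= sumr_const -[e *+ _]mulr_natl mulrDr lerD2l -mulr_suml.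
have -> : \sum_(x in T) (x \in E)%:R = #|E|%:R :> R.
  rewrite -natr_sum; congr (_%:R); rewrite -sum1_card [RHS]big_mkcond [LHS]big_mkcond /=.
  apply: eq_bigr => x _; case xE : (x \in E); last by case: ifP.
  by rewrite (fintype.subsetP ET).
apply: le_trans (_ : #|E|%:R * (e0 * N%:R) <= _); first by rewrite ler_wpM2l.
rewrite mulrCA -natrM (mulrC _ e0) ler_wpM2l ?ler_nat //.
have : 0 < e0 * N%:R by lra.
by rewrite pmulr_lgt0 ?ltr0n ?(ltnW N1) // => /ltW.
Qed.

(** Such a row can be replaced by the two integer rows [al] and row [x] minus [al], with vectors [c]
    and [u x - c]. *)
Definition reducible A u (v : 'I_n -> V) (b e : R) (x : 'I_m) : Prop :=
  exists (c : V) (al : 'I_n -> int),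
    [/\ forall y, `|(al y)%:~R - dot c (v y)| <= e,
        dot c c <= b & dot (u x - c) (u x - c) <= b].

Lemma exists_reducible A u (v : 'I_n -> V) (S : {set 'I_m}) y0 (N k : nat)
    (a G d e e0 : R) :
  (1 < N)%N -> 0 < G -> 0 <= e -> e <= 8^-1 -> 0 <= e0 -> e0 <= 8^-1 ->
  0 < d -> 8 * d * G <= 1 -> a <= G -> 2 * G + 1 <= e0 * N%:R ->
  (forall x, dot (u x) (u x) <= a) -> (forall y, dot (v y) (v y) <= G) ->
  (forall x y, `|(A x y)%:~R - dot (u x) (v y)| <= e) ->
  a < k%:R * d -> ((2 * N) ^ k * 2 <= #|S|)%N ->
  {in S, forall x, A x y0 != 0} -> {in S &, injective (fun x => row x A)} ->
  exists2 x, x \in S & reducible A u v (a - d) (e + e0) x.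
Proof.
move=> N1 G0 e_ge0 e8 e0_ge0 e08 d0 dG aG hN hu hv happ ak cS nz inj.
have N0 : (0 < N)%N by apply: ltnW.
have e2 : e <= 2^-1 by lra.
have sq34 z : 3 / 4 <= z -> 9 / 16 <= z ^+ 2 :> R.
  have p34 : 0 <= 3 / 4 :> R by lra.
  by move=> h; have := ler_pM p34 p34 h h; rewrite expr2; lra.
have dG' : 4 * d * G <= (1 - 2 * e) ^+ 2 by have := sq34 (1 - 2 * e); lra.
have [T [TS T1 mc]] := exists_mostly_constant N0 G0 e2 dG' hu hv happ ak cS.
have T0 : (0 < #|T|)%N by apply: ltnW.
have T0R : 0 < #|T|%:R :> R by rewrite ltr0n.
have [al hal] := choice mc.
have huG x : dot (u x) (u x) <= G by apply: le_trans aG.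
set c := mean u T.
have app y : `|(al y)%:~R - dot c (v y)| <= e + e0.
  exact: (mean_approx G0 e_ge0 e2 hN T0 N1 huG hv happ (hal y)).
(* The average of [dot (u x) c] over [T] is [dot c c], so some row reaches it. *)
have [x0 x0T hx0] : exists2 x, x \in T & dot c c <= dot (u x) c.
  apply: contrapT => no.
  have : \sum_(x in T) dot (u x) c < \sum_(x in T) dot c c.
    apply: ltr_sum.
      have /card_gt0P[x xT] := T0.
      by apply/hasP; exists x; rewrite ?mem_index_enum.
    by move=> x xT; rewrite ltNge; apply/negP => h; apply: no; exists x.
  by rewrite sumr_const -[_ *+ _]mulr_natl -dot_mean // ltxx.
(* Some row of [T] takes the value [al y0] at [y0], so this integer is nonzero and [c] cannot be
   short. *)
have c_lower : d <= dot c c.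
  have [x xT /eqP alx] : exists2 x, x \in T & A x y0 == al y0.
    have /fintype.subsetPn[x xT] : ~~ (T \subset [set x in T | A x y0 != al y0]%SET).
      apply/negP=> /subset_leq_card h.
      have := leq_trans (leq_mul h (leqnn N)) (hal y0).
      by rewrite leqNgt ltn_Pmulr.
    by rewrite inE xT /= negbK; exists x.
  have al1 : 1 <= `|(al y0)%:~R| :> R.
    have := nz x (fintype.subsetP TS x xT); rewrite alx => al0.
    by rewrite -intr_norm ler1z -gtz0_ge1 normr_gt0.
  have := @psd_separated (1 - (e + e0)) G c (v y0) _ _ (hv y0).
  have : 1 - (e + e0) <= `|dot c (v y0)|.
    have := app y0; rewrite distrC => h.
    have := ler_normB (dot c (v y0)) (dot c (v y0) - (al y0)%:~R).
    by rewrite subKr; lra.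
  move=> h1 h2; have {h1}h2 := h2 ltac:(lra) h1.
  by rewrite -(ler_pM2r G0) (le_trans _ h2) //; have := sq34 (1 - (e + e0)); lra.
have c_upper : dot c c <= a - d.
  apply: le_trans hx0 _; rewrite dotC -(ler_pM2l T0R) dot_mean //.
  (* Distinct rows differ by at least 1 in some column, which puts their vectors at squared distance
     at least [4 * d]. *)
  have pair x : x \in T -> x != x0 -> dot (u x) (u x0) <= a - 2 * d.
    move=> xT ne; have [y /negP neA] : exists y, ~ (A x y == A x0 y).
      apply: contrapT => /forallNP h; case/negP: ne.
      apply/eqP/inj; rewrite ?(fintype.subsetP TS) //.
      by apply/rowP=> y; rewrite !mxE; apply/eqP; exact: contrapT (h y).
    have : 1 - 2 * e <= `|dot (u x - u x0) (v y)|.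
      have : 1 <= `|(A x y)%:~R - (A x0 y)%:~R| :> R.
        by rewrite -intrB -intr_norm ler1z -gtz0_ge1 normr_gt0 subr_eq0.
      rewrite !ler_normr dotDl dotNl; have := happ x y; have := happ x0 y.
      rewrite !ler_distl => /andP[? ?] /andP[? ?] /orP[?|?]; apply/orP; [left|right]; lra.
    move=> sep; have s0 : 0 <= 1 - 2 * e by lra.
    have := psd_separated s0 sep (hv y) => far.
    have : 4 * d <= dot (u x - u x0) (u x - u x0).
      by rewrite -(ler_pM2r G0) (le_trans dG').
    by rewrite psd_normB; have := hu x; have := hu x0; lra.
  (* With [t] the size of [T], one term is at most [a] and the other [t - 1] are at most
     [a - 2 * d]; as [t >= 2], the total is at most [t * (a - d)]. *)
  rewrite (bigD1 x0) //=.
  have : \sum_(i in T | i != x0) dot (u i) (u x0) <= \sum_(i in T | i != x0) (a - 2 * d).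
    by apply: ler_sum => x /andP[]; apply: pair.
  have -> : \sum_(i in T | i != x0) (a - 2 * d) = (#|T|%:R - 1) * (a - 2 * d).
    rewrite sumr_const -[_ *+ _]mulr_natl (cardD1 x0 T) x0T /= add1n -[#|_|.+1%:R]natr1 addrK.
    by congr (_%:R * _); apply: eq_card => x; rewrite !inE andbC.
  have : 2 <= #|T|%:R :> R by rewrite ler_nat.
  have := hu x0; have := dot_ge0 c.
  move: (#|T|%:R) => t _ h1 h2 h3.
  have : 0 <= (t - 2) * d by rewrite mulr_ge0 ?subr_ge0 // ltW.
  lra.
exists x0; first exact: (fintype.subsetP TS).
(* By the choice of [x0], the squared norm of [u x0 - c] is at most [a - dot c c], hence at most
   [a - d]. *)
by exists c, al; split=> //; rewrite psd_normB; have := hu x0; lra.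
Qed.

End Rows.
End PsdForm.

(** * Recursion on the norms *)

(** Row and column bounds on squared norms are kept apart, since the recursion lowers one of them at
    a time. *)
Definition approx_factored (R : realType) (V : lmodType R) (dot : V -> V -> R)
    (a b e : R) m n (A : 'M[int]_(m, n)) : Prop :=
  exists (u : 'I_m -> V) (v : 'I_n -> V),
    [/\ forall x, dot (u x) (u x) <= a,
        forall y, dot (v y) (v y) <= b &
        forall x y, `|(A x y)%:~R - dot (u x) (v y)| <= e].

Definition zero_rows m n (P : pred 'I_m) (A : 'M[int]_(m, n)) : 'M[int]_(m, n) :=
  \matrix_(x, y) (if P x then A x y else 0).

(** Erasing rows can merge columns but never separates equal ones. *)
Lemma zero_rows_row_sparse_tr K m n (P : pred 'I_m) (A : 'M[int]_(m, n)) :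
  row_sparse K A^T -> row_sparse K (zero_rows P A)^T.
Proof.
move=> sp x S nz inj; apply: (sp x S) => [y yS|y z yS zS e].
  by have := nz y yS; rewrite !mxE; case: ifP.
apply: inj => //; apply/rowP=> w; rewrite !mxE.
by rewrite (eq_row_tr e).
Qed.

Section Recursion.
Context {R : realType} {V : lmodType R} {dot : V -> V -> R}.
Hypothesis psd : psd_form dot.

Lemma approx_factored_tr a b e m n (A : 'M[int]_(m, n)) :
  approx_factored dot a b e A -> approx_factored dot b a e A^T.
Proof.
move=> [u [v [hu hv h]]]; exists v, u; split=> // x y.
by rewrite mxE; have [-> _ _ _] := psd.
Qed.

Lemma approx_factoredW e e' a b m n (A : 'M[int]_(m, n)) : e <= e' ->
  approx_factored dot a b e A -> approx_factored dot a b e' A.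
Proof.
move=> le [u [v [hu hv h]]]; exists u, v; split=> // x y.
exact: le_trans le.
Qed.

Lemma approx_factored0 b e m n (A : 'M[int]_(m, n)) : e < 1 ->
  approx_factored dot 0 b e A -> A = 0.
Proof.
move=> e1 [u [v [hu hv h]]]; apply/matrixP=> x y; rewrite mxE.
have uv0 : dot (u x) (v y) = 0.
  apply/eqP; rewrite -sqrf_eq0 eq_le sqr_ge0 andbT.
  apply: le_trans (psd_CauchySchwarz psd _ _) _.
  by rewrite mulr_le0_ge0 //; case: psd.
have := h x y; rewrite uv0 subr0 -intr_norm => le_e.
have : `|A x y|%:~R < 1%:~R :> R by apply: le_lt_trans e1.
rewrite ltr_int => lt1; apply/eqP; rewrite -normr_eq0; lia.
Qed.

(** All reducible rows are split at once into [A1] and [A2]. The rows kept by [P] are irreducible,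
    so [exists_reducible] forbids too many distinct ones in a column. *)
Lemma row_step m n (A : 'M[int]_(m, n)) (N k : nat) (a G d e e0 : R) b :
  (1 < N)%N -> 0 < G -> 0 <= e -> e <= 8^-1 -> 0 <= e0 -> e0 <= 8^-1 ->
  0 < d -> 8 * d * G <= 1 -> d <= a -> a <= G -> b <= G ->
  2 * G + 1 <= e0 * N%:R -> a < k%:R * d ->
  approx_factored dot a b e A ->
  exists (A1 A2 : 'M[int]_(m, n)) (P : pred 'I_m),
    [/\ A = A1 + A2 + zero_rows P A,
        approx_factored dot (a - d) b (e + e0) A1,
        approx_factored dot (a - d) b (2 * e + e0) A2,
        approx_factored dot a b e (zero_rows P A) &
        row_sparse ((2 * N) ^ k * 2) (zero_rows P A)].
Proof.
move=> N1 G0 e_ge0 e8 e0_ge0 e08 d0 dG da aG bG hN ak [u [v [hu hv happ]]].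
pose red x := reducible (dot := dot) A u v (a - d) (e + e0) x.
have ex x : exists p : V * ('I_n -> int), red x ->
    [/\ forall y, `|(p.2 y)%:~R - dot p.1 (v y)| <= e + e0,
      dot p.1 p.1 <= a - d & dot (u x - p.1) (u x - p.1) <= a - d].
  have [[p [al h]]|no] := pselect (red x); first by exists (p, al).
  by exists (0, fun=> 0) => /no.
have [c hc] := choice ex.
pose P x := ~~ `[< red x >].
exists (\matrix_(x, y) if P x then 0 else (c x).2 y),
  (\matrix_(x, y) if P x then 0 else A x y - (c x).2 y), P.
have [dotC dotDl dotZl dot_ge0] := psd.
have [d00l d00r] := (psd0l psd, psd0r psd).
have ad0 : 0 <= a - d by rewrite subr_ge0.
split.
- by apply/matrixP=> x y; rewrite !mxE; case: ifP => _; ring.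
- exists (fun x => if P x then 0 else (c x).1), v; split=> //.
    by move=> x; case: ifPn => [_|/negbNE/asboolP/hc[]]; rewrite ?d00l.
  move=> x y; rewrite mxE; case: ifPn => [_|/negbNE/asboolP/hc[]//].
  by rewrite d00l subr0 normr0 addr_ge0.
- exists (fun x => if P x then 0 else u x - (c x).1), v; split=> //.
    by move=> x; case: ifPn => [_|/negbNE/asboolP/hc[]]; rewrite ?d00l.
  move=> x y; rewrite mxE; case: ifPn => [_|/negbNE/asboolP/hc[/(_ y) + _ _]].
    by rewrite d00l subr0 normr0 addr_ge0 // mulr_ge0.
  rewrite dotDl -scaleN1r dotZl rmorphB /=.
  by have := happ x y; rewrite !ler_distl; lra.
- exists (fun x => if P x then u x else 0), v; split=> //.
    by move=> x; case: ifP => _ //; rewrite d00l; lra.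
  by move=> x y; rewrite mxE; case: ifP; rewrite // d00l subr0 normr0.
- move=> y S nz inj; rewrite leqNgt; apply/negP => /ltnW big.
  have PS x : x \in S -> P x.
    by move=> /nz; rewrite mxE; case: ifP; rewrite // eqxx.
  have nzA : {in S, forall x, A x y != 0}.
    by move=> x xS; have := nz x xS; rewrite mxE PS.
  have injA : {in S &, injective (fun x => row x A)}.
    move=> x z xS zS e'; apply: inj => //; apply/rowP=> w; rewrite !mxE !PS //.
    exact: eq_row_entry.
  have hvG z : dot (v z) (v z) <= G by apply: le_trans bG.
  have [x xS xred] := exists_reducible psd N1 G0 e_ge0 e8 e0_ge0 e08 d0 dG aG hN
    hu hvG happ ak big nzA injA.
  by have := PS x xS; rewrite /P asboolT.
Qed.

(* Number of pieces needed once no row and no column can be reduced. *)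
Definition sparse_cost (g c N : nat) : nat :=
  2 * (g * ((2 * N) ^ (c + 1) * 2) ^ 2).

Section Induction.
Variables (g c kmax N : nat) (d : R) (err : nat -> R).
Let K' := sparse_cost g c N.

Hypothesis g0 : (0 < g)%N.
Hypothesis N1 : (1 < N)%N.
Hypothesis dG : 8 * d * g%:R = 1.
Hypothesis cd : c%:R * d = g%:R.
Hypothesis errS : forall k, err k = 4 * err k.+1.
Hypothesis err_gt0 : forall k, 0 < err k.
Hypothesis err0 : forall k, err k <= 16^-1.
Hypothesis err_max : forall k, (k <= kmax)%N -> err kmax <= err k.
Hypothesis hN : 2 * g%:R + 1 <= err kmax * N%:R.

(* [i] and [j] count the remaining norm decrements of the rows and of the columns. *)
Lemma approx_factored_rec k : forall i j, (i + j = k)%N -> (k <= kmax)%N ->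
  (i <= c)%N -> (j <= c)%N ->
  forall m n (A : 'M[int]_(m, n)),
  approx_factored dot (i%:R * d) (j%:R * d) (err k) A ->
  signed_blocky_le A (K' * 4 ^ k - K').
Proof.
elim: k => [|k IH] i j ijk kmx ib jb m n A hA.
  have -> : A = 0; last exact: signed_blocky_le0.
  have i0 : i = 0%N by lia.
  by move: hA; rewrite i0 mul0r; apply: approx_factored0; have := err0 0; lra.
have e1 : err k.+1 < 1 by have := err0 k.+1; lra.
case: i => [|i] in ijk ib hA *.
  have -> : A = 0; last exact: signed_blocky_le0.
  by move: hA; rewrite mul0r; apply: approx_factored0.
case: j => [|j] in ijk jb hA *.
  have -> : A = 0; last exact: signed_blocky_le0.
  apply: trmx_inj; rewrite trmx0; move: hA => /approx_factored_tr.
  by rewrite mul0r; apply: approx_factored0.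
have gR0 : 0 < g%:R :> R by rewrite ltr0n.
have d0 : 0 < d by rewrite -(pmulr_lgt0 _ gR0) -(@pmulr_rgt0 _ 8) // mulrA dG.
have kmx' : (k <= kmax)%N by exact: ltnW.
have ijk1 : (i + j.+1 = k)%N by move: ijk; rewrite addSn => -[].
have ijk2 : (j + i.+1 = k)%N by rewrite addnC addSnnS.
have ib' : (i <= c)%N by exact: ltnW.
have jb' : (j <= c)%N by exact: ltnW.
have bound l : (l <= c)%N -> l%:R * d <= g%:R /\ l%:R * d < (c + 1)%:R * d.
  move=> lb; split; last by rewrite ltr_pM2r // ltr_nat addn1 ltnS.
  by rewrite -cd ler_pM2r // ler_nat.
have [iG ik] := bound _ ib; have [jG jk] := bound _ jb.
have dle l : d <= l.+1%:R * d by rewrite ler_peMl ?ler1n // ltW.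
have predE l : l.+1%:R * d - d = l%:R * d by rewrite -natr1 mulrDl mul1r addrK.
have em : err kmax <= err k.+1 by apply: err_max.
have [ek0 ek8] : 0 <= err k.+1 /\ err k.+1 <= 8^-1.
  by split; [apply: ltW | have := err0 k.+1; lra].
have [em0 em8] : 0 <= err kmax /\ err kmax <= 8^-1.
  by split; [apply: ltW | have := err0 kmax; lra].
have dG' : 8 * d * g%:R <= 1 by rewrite dG.
(* The larger of the two new errors is at most three times the old one; the factor 4 in the
   tolerances absorbs it. *)
have w1 : err k.+1 + err kmax <= err k by rewrite (errS k); lra.
have w2 : 2 * err k.+1 + err kmax <= err k by rewrite (errS k); lra.
have [A1 [A2 [P [eA h1 h2 h3 sp]]]] := row_step N1 gR0 ek0 ek8 em0 em8 d0 dG'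
  (dle i) iG jG hN ik hA.
have [B1 [B2 [Q [eB k1 k2 k3 sq]]]] := row_step N1 gR0 ek0 ek8 em0 em8 d0 dG'
  (dle j) jG iG hN jk (approx_factored_tr h3).
rewrite !predE in h1 h2 k1 k2.
set C := zero_rows Q _ in eB k3 sq.
have sA1 := IH i j.+1 ijk1 kmx' ib' jb _ _ _ (approx_factoredW w1 h1).
have sA2 := IH i j.+1 ijk1 kmx' ib' jb _ _ _ (approx_factoredW w2 h2).
have sB1 := IH j i.+1 ijk2 kmx' jb' ib _ _ _ (approx_factoredW w1 k1).
have sB2 := IH j i.+1 ijk2 kmx' jb' ib _ _ _ (approx_factoredW w2 k2).
have sC : signed_blocky_le C K'.
  apply: (sparse_signed_blocky (K := (2 * N) ^ (c + 1) * 2)) => //.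
    (* The sparsity gained from the row step survives the erasing of columns in the column step. *)
    by apply: zero_rows_row_sparse_tr; rewrite trmxK.
  (* An entry is within [err k.+1 < 1] of an inner product of size at most [g], so as an integer it
     is at most [g] in absolute value. *)
  move=> x y; have [u [v [hu hv happ]]] := k3.
  have := psd_norm_bound psd (le_trans (hu x) jG) (le_trans (hv y) iG).
  have := happ x y; rewrite ler_distl => /andP[h h']; rewrite ler_norml => /andP[l l'].
  have : (C x y)%:~R < (g%:Z + 1)%:~R :> R by rewrite intrD -pmulrn; lra.
  have : (- (g%:Z + 1))%:~R < (C x y)%:~R :> R by rewrite rmorphN /= intrD -pmulrn; lra.
  by rewrite !ltr_int; move: (C x y) g%:Z => z w; clear; lia.
rewrite eA; have -> : zero_rows P A = (B1 + B2 + C)^T by rewrite -eB trmxK.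
(* Four recursive calls and one sparse remainder; subtracting [K'] in the bound leaves room for the
   remainder. *)
apply: signed_blocky_leW (signed_blocky_leD (signed_blocky_leD sA1 sA2)
  (signed_blocky_le_tr (signed_blocky_leD (signed_blocky_leD sB1 sB2) sC))).
rewrite expnS; have : (0 < 4 ^ k)%N by rewrite expn_gt0.
move: (4 ^ k)%N K' => x y; clear => x0.
have : (y <= y * x)%N by rewrite leq_pmulr.
by rewrite mulnCA; lia.
Qed.

End Induction.

(** * Explicit parameters *)

Lemma sparse_cost_bound g : (0 < g)%N ->
  (sparse_cost g (8 * g ^ 2) (16 * 4 ^ (16 * g ^ 2) * (2 * g + 1))
     * 4 ^ (16 * g ^ 2) <= 2 ^ (756 * g ^ 4))%N.
Proof.
move=> g0; rewrite /sparse_cost.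
set N := (16 * 4 ^ _ * _)%N; set K := ((2 * N) ^ _ * 2)%N.
have p2 a b : (a <= b)%N -> (2 ^ a <= 2 ^ b)%N by move=> h; rewrite leq_pexp2l.
have four k : (4 ^ k = 2 ^ (2 * k))%N by rewrite expnM.
have g1 : (g <= 2 ^ g)%N by apply/ltnW/ltn_expl.
have gg : (g <= g ^ 2)%N by rewrite -{1}(expn1 g) leq_pexp2l.
have g24 : (g ^ 2 <= g ^ 4)%N by rewrite leq_pexp2l.
have g4 : (0 < g ^ 4)%N by rewrite expn_gt0 g0.
have N_le : (2 * N <= 2 ^ (40 * g ^ 2))%N.
  have g2 : (2 * g + 1 <= 2 ^ (g + 2))%N.
    by move: g0 g1; rewrite expnD -[(2 ^ 2)%N]/4%N; move: (2 ^ g)%N => z; clear; lia.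
  apply: (@leq_trans (2 * (2 ^ 4 * 2 ^ (2 * (16 * g ^ 2)) * 2 ^ (g + 2)))).
    by rewrite /N four leq_mul // leq_mul.
  rewrite -!expnD -expnS; apply: p2; lia.
have K_le : (K <= 2 ^ (361 * g ^ 4))%N.
  apply: (@leq_trans ((2 ^ (40 * g ^ 2)) ^ (8 * g ^ 2 + 1) * 2)).
    by rewrite leq_mul // leq_exp2r // addn1.
  rewrite -expnM -expnSr; apply: p2.
  have -> : (40 * g ^ 2 * (8 * g ^ 2 + 1) = 320 * g ^ 4 + 40 * g ^ 2)%N.
    by rewrite (_ : 4 = 2 * 2)%N // expnM; move: (g ^ 2)%N => z; clear; nia.
  lia.
(* The exponent is [1 + g + 722 * g ^ 4 + 32 * g ^ 2], hence at most [756 * g ^ 4]. *)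
apply: (@leq_trans (2 * (2 ^ g * (2 ^ (361 * g ^ 4)) ^ 2) * 2 ^ (2 * (16 * g ^ 2)))).
  by rewrite four leq_mul // leq_mul // leq_mul // leq_exp2r.
rewrite -expnM -expnD -expnS -expnD; apply: p2; lia.
Qed.

Lemma approx_factored_signed_blocky g m n (A : 'M[int]_(m, n)) : (0 < g)%N ->
  approx_factored dot g%:R g%:R (16 * 4 ^+ (16 * g ^ 2))^-1 A ->
  signed_blocky_le A (2 ^ (756 * g ^ 4)).
Proof.
move=> g0 hA.
(* The largest decrement with [8 * d * g%:R <= 1]; [8 * g ^ 2] of them exhaust [g], so rows and
   columns together allow [16 * g ^ 2] steps. *)
pose d : R := (8 * g%:R)^-1.
pose err (k : nat) : R := (16 * 4 ^+ k)^-1.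
have gR0 : (0 : R) < g%:R by rewrite ltr0n.
have gn0 : (g%:R : R) != 0 by rewrite gt_eqF.
have p4 k : (0 : R) < 16 * 4 ^+ k by rewrite mulr_gt0 // exprn_gt0.
have dg : 8 * d * g%:R = 1 by rewrite /d; field.
have cd : (8 * g ^ 2)%:R * d = g%:R by rewrite natrM natrX /d; field.
have errS k : err k = 4 * err k.+1.
  by rewrite /err exprS; field; rewrite expf_neq0 // pnatr_eq0.
have err_gt0 k : 0 < err k by rewrite invr_gt0.
have err0 k : err k <= 16^-1.
  by rewrite lef_pV2 ?posrE // ler_peMr // exprn_ege1 // ler1n.
have err_max k l : (k <= l)%N -> err l <= err k.
  by move=> le; rewrite lef_pV2 ?posrE // ler_pM2l // ler_weXn2l // ler1n.
set kmax := (16 * g ^ 2)%N in hA.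
(* Chosen so that the averaging error [(2 * g + 1) / N] equals the final tolerance [err kmax]. *)
pose N := (16 * 4 ^ kmax * (2 * g + 1))%N.
have N1 : (1 < N)%N.
  have : (0 < 4 ^ kmax)%N by rewrite expn_gt0.
  by rewrite /N; move: (4 ^ kmax)%N => z; clear; nia.
have hN : 2 * g%:R + 1 <= err kmax * N%:R.
  by rewrite /N !natrM natrX natrD natrM mulrA mulVf ?mul1r // gt_eqF.
have kE : (8 * g ^ 2 + 8 * g ^ 2 = kmax)%N by rewrite -mulnDl.
rewrite -cd in hA.
have h := approx_factored_rec g0 N1 dg cd errS err_gt0 err0 (fun k => @err_max k kmax)
  hN kE (leqnn _) (leqnn _) (leqnn _) hA.
apply: signed_blocky_leW h.
exact: leq_trans (leq_subr _ _) (sparse_cost_bound g0).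
Qed.

End Recursion.

(** * From factorization norm to approximate factorizations *)

Lemma psd_form_dot (R : realType) (V : completeNormedModType R) (dot : {dot V for idfun}) :
  psd_form (dot : V -> V -> R).
Proof.
have dotC u v : dot u v = dot v u by have := hermC dot u v; rewrite expr0 mul1r.
split=> // [u v w|a u v|u].
- by rewrite linearDl.
- by rewrite linearZl_LR.
- have [->|/neq0_dnorm_gt0/ltW //] := eqVneq u 0.
  by rewrite linear0r.
Qed.

Lemma le_sup_range_ord (R : realType) k (f : 'I_k -> R) i : f i <= sup (range f).
Proof.
apply: ub_le_sup; last by exists i.
exists (\sum_j `|f j|) => _ [j _ <-].
by rewrite (bigD1 j) //= (le_trans (ler_norm _)) // lerDl sumr_ge0.
Qed.

Lemma mx_neq0 m n (A : 'M[int]_(m, n)) : A != 0 -> exists x y, A x y != 0.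
Proof.
move=> nzA; apply: contrapT => no; case/negP: nzA; apply/eqP/matrixP => x y.
by rewrite mxE; apply/eqP; apply: contrapT => /negP nz; apply: no; exists x, y.
Qed.

Lemma gamma2_approx_factored (R : realType) m n (A : 'M[int]_(m, n)) (gamma e : R) :
  0 < e -> A != 0 -> (gamma2 (int_to_real_mx R A) <= gamma%:E)%E ->
  exists (V : lmodType R) (dot : V -> V -> R),
    psd_form dot /\ approx_factored dot (gamma + e) (gamma + e) e A.
Proof.
move=> e0 nzA le_gamma.
have : (gamma2 (int_to_real_mx R A) < (gamma + e)%:E)%E.
  by apply: le_lt_trans le_gamma _; rewrite lte_fin ltrDl.
move=> /ereal_inf_lt[_ [r [V [dot [u [v [hd hA hr]]]]] <-]]; rewrite lte_fin => r_lt.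
have psd := psd_form_dot dot.
exists V, dot; split=> //.
set su := sup (range (fun x => `|u x|)) in hr.
set sv := sup (range (fun x => `|v x|)) in hr.
have hu x : `|u x| <= su by apply: (le_sup_range_ord (fun x => `|u x|)).
have hv x : `|v x| <= sv by apply: (le_sup_range_ord (fun x => `|v x|)).
have [x [y nzxy]] := mx_neq0 nzA.
have nzdot : dot (u x) (v y) != 0.
  by rewrite -hA mxE intr_eq0.
have u0 : u x != 0.
  by apply: contra nzdot => /eqP ->; rewrite (psd0l psd).
have v0 : v y != 0.
  by apply: contra nzdot => /eqP ->; rewrite (psd0r psd).
have su0 : 0 < su by apply: lt_le_trans (hu x); rewrite normr_gt0.
have sv0 : 0 < sv by apply: lt_le_trans (hv y); rewrite normr_gt0.
have [su_ge0 sv_ge0] := (ltW su0, ltW sv0).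
(* Scaling [u] by [t] and [v] by its inverse balances the two suprema: both squared norms become at
   most [su * sv], which is below [gamma + e]. *)
pose t := Num.sqrt (sv / su).
have t0 : 0 < t by rewrite sqrtr_gt0 divr_gt0.
have t2 : t ^+ 2 = sv / su by rewrite sqr_sqrtr // divr_ge0 // ltW.
have [dotC dotDl dotZl dot_ge0] := psd.
exists (fun x => t *: u x), (fun y => t^-1 *: v y); split.
- move=> z; rewrite dotZl dotC dotZl mulrA -expr2 -hd t2.
  apply: le_trans (ltW r_lt); rewrite hr.
  have -> : su * sv = sv / su * su ^+ 2 by field; rewrite gt_eqF.
  by rewrite ler_wpM2l ?divr_ge0 // ler_pXn2r ?nnegrE.
- move=> z; rewrite dotZl dotC dotZl mulrA -expr2 -hd exprVn t2.
  apply: le_trans (ltW r_lt); rewrite hr.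
  have -> : su * sv = (sv / su)^-1 * sv ^+ 2 by field; rewrite !gt_eqF.
  by rewrite ler_wpM2l ?invr_ge0 ?divr_ge0 // ler_pXn2r ?nnegrE.
- move=> z w; have := hA z w; rewrite mxE => -> /=.
  rewrite dotZl dotC dotZl mulrA mulfV ?gt_eqF // mul1r dotC subrr normr0.
  exact: ltW.
Qed.

Lemma natr_pow2_le_powR (R : realType) (c g : nat) (gamma : R) :
  g%:R <= 4 * gamma ->
  (2 ^ (c * g ^ 4))%:R <= 2 `^ (c%:R * 4 ^+ 4 * gamma ^+ 4) :> R.
Proof.
move=> g_le; rewrite natrX -powR_mulrn //.
apply: ler_powR; first by rewrite ler1n.
rewrite natrM natrX -mulrA -exprMn; apply: ler_wpM2l => //.
by apply: lerXn2r; rewrite ?nnegrE //; apply: le_trans g_le.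
Qed.

(** A nonzero integer matrix forces [gamma >= 1/2], so rounding [gamma] up to an integer [g] costs
    only a constant factor; the zero matrix is the empty sum. *)
Lemma approx_factored_signed_blocky_sum (R : realType) m n (A : 'M[int]_(m, n)) (gamma : R) :
  (forall e, 0 < e -> A != 0 -> exists (V : lmodType R) (dot : V -> V -> R),
    psd_form dot /\ approx_factored dot (gamma + e) (gamma + e) e A) ->
  exists L : nat, L%:R <= 2 `^ (756%:R * 4 ^+ 4 * gamma ^+ 4) /\ signed_blocky_sum A L.
Proof.
move=> fact; have [A0|nzA] := eqVneq A 0.
  have [L] := signed_blocky_le_sum (signed_blocky_le0 m n 0); rewrite -A0 leqn0 => /eqP -> ?.
  by exists 0%N; split=> //; apply: powR_ge0.
have gamma_ge : 2^-1 <= gamma.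
  have [V [dot [psd [u [v [hu hv happ]]]]]] := fact 4^-1 ltac:(by []) nzA.
  have [x [y nzxy]] := mx_neq0 nzA.
  have := psd_norm_bound psd (hu x) (hv y); have := happ x y; rewrite distrC.
  have : 1 <= `|(A x y)%:~R| :> R by rewrite -intr_norm ler1z -gtz0_ge1 normr_gt0.
  have := ler_normB (dot (u x) (v y)) (dot (u x) (v y) - (A x y)%:~R).
  by rewrite subKr; lra.
pose g := (Num.truncn (gamma + 2^-1)).+1.
have g_gt : gamma + 2^-1 <= g%:R by apply/ltW/truncnS_gt.
have g_le : g%:R <= 4 * gamma.
  have : (Num.truncn (gamma + 2^-1))%:R <= gamma + 2^-1 by rewrite truncn_le; lra.
  by rewrite -[g%:R]natr1; lra.
pose e : R := (16 * 4 ^+ (16 * g ^ 2))^-1.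
have e0 : 0 < e by rewrite invr_gt0 mulr_gt0 // exprn_gt0.
have e2 : e <= 2^-1.
  rewrite lef_pV2 ?posrE ?mulr_gt0 ?exprn_gt0 //.
  have : 1 <= 4 ^+ (16 * g ^ 2) :> R by rewrite exprn_ege1 // ler1n.
  lra.
have [V [dot [psd [u [v [hu hv happ]]]]]] := fact e e0 nzA.
have fA : approx_factored dot g%:R g%:R e A.
  by exists u, v; split=> // z; [apply: le_trans (hu z) _|apply: le_trans (hv z) _]; lra.
have := approx_factored_signed_blocky psd (ltn0Sn _) fA.
move=> /signed_blocky_le_sum[L L_le sumL]; exists L; split=> //.
apply: (@le_trans _ _ (2 ^ (756 * g ^ 4))%:R); first by rewrite ler_nat.
exact: natr_pow2_le_powR.
Qed.

(** * From Schur multiplier norm to approximate factorizations *)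

Section L2.
Context {R : realType}.

Lemma l2norm_ge0 n (x : 'cV[R]_n) : 0 <= l2norm x.
Proof. exact: sqrtr_ge0. Qed.

Lemma sqr_l2norm n (x : 'cV[R]_n) : l2norm x ^+ 2 = \sum_i x i 0 ^+ 2.
Proof. by rewrite sqr_sqrtr // sumr_ge0 // => i _; rewrite sqr_ge0. Qed.

Lemma l2normZ n (c : R) (x : 'cV[R]_n) : 0 <= c -> l2norm (c *: x) = c * l2norm x.
Proof.
move=> c0; apply/eqP; rewrite -(@eqrXn2 _ 2) ?mulr_ge0 ?l2norm_ge0 //.
rewrite exprMn !sqr_l2norm mulr_sumr; apply/eqP/eq_bigr => i _.
by rewrite mxE exprMn.
Qed.

Lemma l2norm_eq0 n (x : 'cV[R]_n) : l2norm x = 0 -> x = 0.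
Proof.
move=> x0; have : \sum_i x i 0 ^+ 2 = 0 by rewrite -sqr_l2norm x0 expr0n.
move/psumr_eq0P => h; apply/matrixP => i j; rewrite ord1 mxE.
by apply/eqP; rewrite -sqrf_eq0 h // => k _; rewrite sqr_ge0.
Qed.

Lemma l2_opnorm_le m n (B : 'M[R]_(m, n)) (c : R) : 
  (l2_opnorm B <= c%:E)%E -> forall x, l2norm (B *m x) <= c * l2norm x.
Proof.
move=> hB x; have [x0|nx] := eqVneq (l2norm x) 0.
  by rewrite x0 (l2norm_eq0 x0) mulmx0 mulr0 -(scale0r 0) l2normZ // mul0r.
have xp : 0 < l2norm x by rewrite lt_neqAle eq_sym nx l2norm_ge0.
have unit : l2norm ((l2norm x)^-1 *: x) <= 1 by rewrite l2normZ ?invr_ge0 ?l2norm_ge0 // mulVf.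
have : ((l2norm (B *m ((l2norm x)^-1 *: x)))%:E <= c%:E)%E.
  by apply: le_trans hB; apply: ereal_sup_ubound; exists ((l2norm x)^-1 *: x).
by rewrite lee_fin -scalemxAr l2normZ ?invr_ge0 ?l2norm_ge0 // ler_pdivrMl // mulrC.
Qed.

(** Testing with [s = B *m t] bounds the squared norm of [B *m t] by the average of itself and that
    of [t]. *)
Lemma l2_opnorm_le1 m n (B : 'M[R]_(m, n)) :
  (forall (s : 'cV[R]_m) (t : 'cV[R]_n), (s^T *m B *m t) 0 0 <=
    2^-1 * (\sum_x s x 0 ^+ 2 + \sum_y t y 0 ^+ 2)) ->
  (l2_opnorm B <= 1%:E)%E.
Proof.
move=> hB; apply: ge_ereal_sup => _ [t /= t1 <-]; rewrite lee_fin.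
have := hB (B *m t) t; rewrite -mulmxA mxE.
have -> : \sum_j (B *m t)^T 0 j * (B *m t) j 0 = l2norm (B *m t) ^+ 2.
  by rewrite sqr_l2norm; apply: eq_bigr => i _; rewrite [X in X * _]mxE.
rewrite -!sqr_l2norm => h; apply: le_trans t1.
by rewrite -(@ler_pXn2r _ 2) ?nnegrE ?l2norm_ge0 //; lra.
Qed.

Lemma l2_CauchySchwarz n (s t : 'cV[R]_n) : (s^T *m t) 0 0 <= l2norm s * l2norm t.
Proof.
have psd : psd_form (fun s t : 'cV[R]_n => (s^T *m t) 0 0).
  split.
  - by move=> u v; rewrite !mxE; apply: eq_bigr => i _; rewrite !mxE mulrC.
  - by move=> u v w; rewrite linearD mulmxDl mxE.
  - by move=> a u v; rewrite linearZ -scalemxAl mxE.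
  - by move=> u; rewrite mxE sumr_ge0 // => i _; rewrite mxE -expr2 sqr_ge0.
have self (x : 'cV[R]_n) : (x^T *m x) 0 0 = l2norm x ^+ 2.
  by rewrite sqr_l2norm mxE; apply: eq_bigr => i _; rewrite mxE.
have := psd_CauchySchwarz psd s t; rewrite !self -exprMn => h.
apply: le_trans (ler_norm _) _.
by rewrite -(@ler_pXn2r _ 2) ?nnegrE ?mulr_ge0 ?l2norm_ge0 // real_normK ?num_real.
Qed.

End L2.

(** * Near-minimizers of a penalized factorization problem *)

Section Schur.
Context {R : realType} {m n : nat} (M : 'M[R]_(m, n)) (gamma : R).
Implicit Types N : 'M[R]_(m, n).

Definition factor_data N (d : 'I_m -> R) (d' : 'I_n -> R) : Prop :=
  exists k (F : 'M[R]_(m, k)) (H : 'M[R]_(n, k)),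
    [/\ N = F *m H^T, forall x, d x = (F *m F^T) x x & forall y, d' y = (H *m H^T) y y].

Lemma gram_diag_ge0 k p (F : 'M[R]_(p, k)) x : 0 <= (F *m F^T) x x.
Proof. by rewrite mxE sumr_ge0 // => i _; rewrite mxE -expr2 sqr_ge0. Qed.

Lemma factor_data_ge0 N d d' : factor_data N d d' ->
  (forall x, 0 <= d x) /\ (forall y, 0 <= d' y).
Proof.
by move=> [k [F [H [_ hd hd']]]]; split=> z; rewrite ?hd ?hd' gram_diag_ge0.
Qed.

Lemma factor_data0 : factor_data 0 (fun=> 0) (fun=> 0).
Proof. by exists 0%N, 0, 0; split=> [|x|y]; rewrite ?mul0mx ?mxE. Qed.

Lemma factor_dataZ c N d d' : 0 <= c -> factor_data N d d' ->
  factor_data (c *: N) (fun x => c * d x) (fun y => c * d' y).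
Proof.
move=> c0 [k [F [H [-> hd hd']]]]; exists k, (Num.sqrt c *: F), (Num.sqrt c *: H).
have sq : Num.sqrt c * Num.sqrt c = c by rewrite -expr2 sqr_sqrtr.
by split=> [|x|y]; rewrite linearZ /= -scalemxAl -scalemxAr scalerA sq // mxE ?hd ?hd'.
Qed.

(** Append the columns [s] and [t], scaled by the square root of [c], to the two factors. *)
Lemma factor_data_rank1 c N d d' (s : 'cV[R]_m) (t : 'cV[R]_n) :
  0 <= c -> factor_data N d d' ->
  factor_data (N + c *: (s *m t^T)) (fun x => d x + c * s x 0 ^+ 2)
    (fun y => d' y + c * t y 0 ^+ 2).
Proof.
move=> c0 [k [F [H [-> hd hd']]]].
exists (k + 1)%N, (row_mx F (Num.sqrt c *: s)), (row_mx H (Num.sqrt c *: t)).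
have sq : Num.sqrt c * Num.sqrt c = c by rewrite -expr2 sqr_sqrtr.
have outer p (z : 'cV[R]_p) x : (z *m z^T) x x = z x 0 ^+ 2.
  by rewrite mxE big_ord1 mxE expr2.
by split=> [|x|y]; rewrite tr_row_mx mul_row_col [(_ *: _)^T]linearZ /=
  -scalemxAl -scalemxAr scalerA sq // !mxE ?hd ?hd' -?outer; congr (_ + _);
  rewrite !mxE.
Qed.

Definition excess (a : R) : R := Num.max 0 (a - gamma).

Lemma excess_ge0 a : 0 <= excess a. Proof. by rewrite le_max lexx. Qed.

Lemma excessM a : 0 <= gamma -> excess a * a = gamma * excess a + excess a ^+ 2.
Proof. by move=> g0; rewrite /excess; case: (leP 0 (a - gamma)) => _; ring. Qed.

Lemma sqr_le_excess a : 0 <= gamma -> 0 <= a -> a ^+ 2 <= 2 * gamma ^+ 2 + 2 * excess a ^+ 2.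
Proof.
move=> g0 a0; rewrite /excess; case: (leP 0 (a - gamma)) => h.
  by have := sqr_ge0 (2 * gamma - a); nra.
by have := sqr_ge0 gamma; nra.
Qed.

(** Replaces the piecewise penalty by a quadratic polynomial in [c] with the right first-order
    term. *)
Lemma sqr_excess_shrink a c : 0 <= a -> 0 <= c ->
  excess ((1 - c) * a) ^+ 2 <= (excess a - c * a) ^+ 2.
Proof.
move=> a0 c0; have ca : 0 <= c * a by rewrite mulr_ge0.
rewrite /excess; case: (leP 0 (a - gamma)) => h.
  case: (leP 0 ((1 - c) * a - gamma)) => h'.
    by rewrite le_eqVlt; apply/orP; left; apply/eqP; ring.
  by rewrite expr0n sqr_ge0.
case: (leP 0 ((1 - c) * a - gamma)) => h'; first by exfalso; lra.
by rewrite expr0n sqr_ge0.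
Qed.

Lemma sqr_excessD a b : 0 <= b -> excess (a + b) ^+ 2 <= (excess a + b) ^+ 2.
Proof.
move=> b0; have e0 := excess_ge0 a.
rewrite ler_pXn2r ?nnegrE ?excess_ge0 ?addr_ge0 //.
rewrite /excess ge_max; apply/andP; split; first by rewrite addr_ge0 // le_max lexx.
have : a - gamma <= Num.max 0 (a - gamma) by rewrite le_max lexx orbT.
lra.
Qed.

Definition defect N (d : 'I_m -> R) (d' : 'I_n -> R) : R :=
  \sum_x \sum_y (M x y - N x y) ^+ 2 + \sum_x excess (d x) ^+ 2
  + \sum_y excess (d' y) ^+ 2.

Lemma defect_ge0 N d d' : 0 <= defect N d d'.
Proof.
by rewrite !addr_ge0 // sumr_ge0 // => x _; rewrite ?sqr_ge0 // sumr_ge0 // => y _;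
  rewrite sqr_ge0.
Qed.

(** Approximate minimality stands in for an attained infimum; the stationarity inequalities then
    carry an additive [tau]. *)
Lemma near_minimizer tau : 0 < tau -> exists N d d',
  factor_data N d d' /\ forall N1 d1 d1', factor_data N1 d1 d1' ->
    defect N d d' <= defect N1 d1 d1' + tau.
Proof.
move=> tau0.
pose E := [set r : R | exists N d d', factor_data N d d' /\ r = defect N d d']%classic.
have lbE : lbound E 0 by move=> _ [N [d [d' [_ ->]]]]; apply: defect_ge0.
have infE : has_inf E.
  split; last by exists 0.
  exists (defect 0 (fun=> 0) (fun=> 0)), 0, (fun=> 0), (fun=> 0).
  by split=> //; apply: factor_data0.
have [_ [N [d [d' [fN ->]]]] lt_inf] := inf_adherent tau0 infE.
exists N, d, d'; split=> // N1 d1 d1' f1; apply: le_trans (ltW lt_inf) _.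
by rewrite lerD2r; apply: ge_inf; [exists 0 | exists N1, d1, d1'].
Qed.

Lemma sum_quadratic (I : finType) (f g h : I -> R) c :
  \sum_i (f i + c * g i + c ^+ 2 * h i) =
  \sum_i f i + c * (\sum_i g i) + c ^+ 2 * (\sum_i h i).
Proof. by rewrite !big_split /= -!mulr_sumr. Qed.

Lemma sum_quadratic2 (I J : finType) (f g h : I -> J -> R) c :
  \sum_i \sum_j (f i j + c * g i j + c ^+ 2 * h i j) =
  \sum_i \sum_j f i j + c * (\sum_i \sum_j g i j) + c ^+ 2 * (\sum_i \sum_j h i j).
Proof. by rewrite -sum_quadratic; apply: eq_bigr => i _; rewrite sum_quadratic. Qed.

Section NearMinimizer.
Variables (N : 'M[R]_(m, n)) (d : 'I_m -> R) (d' : 'I_n -> R) (tau : R).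
Hypothesis gamma0 : 0 <= gamma.
Hypothesis dataN : factor_data N d d'.
Hypothesis minN : forall N1 d1 d1', factor_data N1 d1 d1' ->
  defect N d d' <= defect N1 d1 d1' + tau.

(** Stationarity under scaling: compare with the data multiplied by [1 - c] and isolate the
    first-order term in [c]. *)
Lemma near_minimizer_shrink c : 0 <= c -> c <= 1 ->
  c * (\sum_x 2 * (excess (d x) * d x) + \sum_y 2 * (excess (d' y) * d' y)
       - \sum_x \sum_y 2 * ((M x y - N x y) * N x y)) <=
  tau + c ^+ 2 * (\sum_x \sum_y N x y ^+ 2 + \sum_x d x ^+ 2 + \sum_y d' y ^+ 2).
Proof.
move=> c0 c1; have [d0 d'0] := factor_data_ge0 dataN.
have c10 : 0 <= 1 - c by rewrite subr_ge0.
have := minN (factor_dataZ c10 dataN); rewrite {2}/defect.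
have -> : \sum_x \sum_y (M x y - ((1 - c) *: N) x y) ^+ 2 =
    \sum_x \sum_y ((M x y - N x y) ^+ 2 + c * (2 * ((M x y - N x y) * N x y))
      + c ^+ 2 * N x y ^+ 2).
  by apply: eq_bigr => x _; apply: eq_bigr => y _; rewrite mxE; ring.
have h1 : \sum_x excess ((1 - c) * d x) ^+ 2 <=
    \sum_x (excess (d x) ^+ 2 + (- c) * (2 * (excess (d x) * d x)) + (- c) ^+ 2 * d x ^+ 2).
  apply: ler_sum => x _; apply: le_trans (sqr_excess_shrink (d0 x) c0) _.
  by rewrite le_eqVlt; apply/orP; left; apply/eqP; ring.
have h2 : \sum_x excess ((1 - c) * d' x) ^+ 2 <=
    \sum_x (excess (d' x) ^+ 2 + (- c) * (2 * (excess (d' x) * d' x)) + (- c) ^+ 2 * d' x ^+ 2).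
  apply: ler_sum => x _; apply: le_trans (sqr_excess_shrink (d'0 x) c0) _.
  by rewrite le_eqVlt; apply/orP; left; apply/eqP; ring.
move: h1 h2; rewrite sum_quadratic2 !sum_quadratic sqrrN /defect; lra.
Qed.

(** Stationarity under adding [c *: (s *m t^T)], with an explicit second-order remainder. *)
Lemma near_minimizer_rank1 c (s : 'cV[R]_m) (t : 'cV[R]_n) : 0 <= c ->
  c * (\sum_x \sum_y 2 * ((M x y - N x y) * (s x 0 * t y 0))
       - \sum_x 2 * (excess (d x) * s x 0 ^+ 2)
       - \sum_y 2 * (excess (d' y) * t y 0 ^+ 2)) <=
  tau + c ^+ 2 * (\sum_x s x 0 ^+ 2 + \sum_y t y 0 ^+ 2) ^+ 2.
Proof.
move=> c0.
have := minN (factor_data_rank1 s t c0 dataN); rewrite {2}/defect.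
have -> : \sum_x \sum_y (M x y - (N + c *: (s *m t^T)) x y) ^+ 2 =
    \sum_x \sum_y ((M x y - N x y) ^+ 2
      + (- c) * (2 * ((M x y - N x y) * (s x 0 * t y 0)))
      + (- c) ^+ 2 * (s x 0 ^+ 2 * t y 0 ^+ 2)).
  by apply: eq_bigr => x _; apply: eq_bigr => y _; rewrite !mxE big_ord1 !mxE; ring.
have bnd p (f : 'I_p -> R) (z : 'cV[R]_p) : \sum_x excess (f x + c * z x 0 ^+ 2) ^+ 2 <=
    \sum_x (excess (f x) ^+ 2 + c * (2 * (excess (f x) * z x 0 ^+ 2))
      + c ^+ 2 * (z x 0 ^+ 2) ^+ 2).
  apply: ler_sum => x _; apply: (le_trans (sqr_excessD _ _)).
    by rewrite mulr_ge0 // sqr_ge0.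
  by rewrite le_eqVlt; apply/orP; left; apply/eqP; ring.
have quart p (z : 'cV[R]_p) : \sum_x (z x 0 ^+ 2) ^+ 2 <= (\sum_x z x 0 ^+ 2) ^+ 2.
  rewrite [leRHS]expr2 mulr_suml; apply: ler_sum => x _.
  rewrite expr2 ler_wpM2l ?sqr_ge0 // (bigD1 x) //= lerDl sumr_ge0 // => y _.
  exact: sqr_ge0.
have prod : \sum_x \sum_y s x 0 ^+ 2 * t y 0 ^+ 2 =
    (\sum_x s x 0 ^+ 2) * (\sum_y t y 0 ^+ 2).
  by rewrite mulr_suml; apply: eq_bigr => x _; rewrite mulr_sumr.
have S0 : 0 <= \sum_x s x 0 ^+ 2 by apply: sumr_ge0 => x _; apply: sqr_ge0.
have T0 : 0 <= \sum_x t x 0 ^+ 2 by apply: sumr_ge0 => x _; apply: sqr_ge0.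
have := ler_wpM2l (sqr_ge0 c) (quart _ s); have := ler_wpM2l (sqr_ge0 c) (quart _ t).
have := mulr_ge0 (sqr_ge0 c) (mulr_ge0 S0 T0).
move: (bnd _ d s) (bnd _ d' t); rewrite sum_quadratic2 !sum_quadratic sqrrN prod /defect.
lra.
Qed.

Lemma near_minimizer_bilinear (kappa : R) (s : 'cV[R]_m) (t : 'cV[R]_n) :
  0 < kappa -> tau = kappa ^+ 2 ->
  \sum_x \sum_y (M x y - N x y) * (s x 0 * t y 0) <=
  \sum_x (excess (d x) + kappa) * s x 0 ^+ 2
  + \sum_y (excess (d' y) + kappa) * t y 0 ^+ 2.
Proof.
move=> k0 tauE; set rho := \sum_x s x 0 ^+ 2 + \sum_y t y 0 ^+ 2.
have Kp p (f : 'I_p -> R) (z : 'cV[R]_p) : \sum_x (excess (f x) + kappa) * z x 0 ^+ 2 =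
    \sum_x excess (f x) * z x 0 ^+ 2 + kappa * \sum_x z x 0 ^+ 2.
  by rewrite mulr_sumr -big_split; apply: eq_bigr => x _; rewrite mulrDl.
rewrite !Kp.
have rho0 : 0 <= rho by rewrite addr_ge0 // sumr_ge0 // => x _; apply: sqr_ge0.
have key c : 0 <= c -> c * 2 * (\sum_x \sum_y (M x y - N x y) * (s x 0 * t y 0)
    - \sum_x excess (d x) * s x 0 ^+ 2 - \sum_y excess (d' y) * t y 0 ^+ 2)
    <= kappa ^+ 2 + c ^+ 2 * rho ^+ 2.
  move=> c0; have := near_minimizer_rank1 s t c0; rewrite tauE.
  rewrite -!mulr_sumr; under eq_bigr => x _ do rewrite -mulr_sumr.
  by rewrite -mulr_sumr -/rho; lra.
suff : \sum_x \sum_y (M x y - N x y) * (s x 0 * t y 0)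
    - \sum_x excess (d x) * s x 0 ^+ 2 - \sum_y excess (d' y) * t y 0 ^+ 2
    <= kappa * rho by rewrite /rho; lra.
move: key; set X := (X in X <= _); rewrite -/X => key.
move: rho0; rewrite le_eqVlt => /orP[/eqP r0|rp].
  rewrite -r0 mulr0 leNgt; apply/negP => X0.
  (* When [s] and [t] vanish there is no quadratic term, and this [c] would give
     [2 * kappa ^+ 2 <= kappa ^+ 2]. *)
  have := key (kappa ^+ 2 / X) (divr_ge0 (sqr_ge0 _) (ltW X0)).
  rewrite -r0 expr0n mulr0 addr0.
  have -> : kappa ^+ 2 / X * 2 * X = 2 * kappa ^+ 2 by field; rewrite gt_eqF.
  by have : 0 < kappa ^+ 2 by [rewrite exprn_gt0]; lra.
(* This [c] balances the error [kappa ^+ 2] against the quadratic term. *)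
have := key (kappa / rho) (divr_ge0 (ltW k0) (ltW rp)).
have -> : kappa ^+ 2 + (kappa / rho) ^+ 2 * rho ^+ 2 = (kappa / rho) * 2 * (kappa * rho).
  by field; rewrite gt_eqF.
by rewrite ler_pM2l // mulr_gt0 // divr_gt0.
Qed.

(* Rescaling by the square roots of the weights turns the bilinear bound into
   [l2_opnorm <= 1]; testing the Schur multiplier on this matrix, between the
   same two vectors, bounds the pairing. *)
Lemma near_minimizer_pairing (kappa : R) : 0 < kappa -> tau = kappa ^+ 2 ->
  (schur_norm M <= gamma%:E)%E ->
  \sum_x \sum_y M x y * (M x y - N x y) <=
  gamma * (\sum_x (excess (d x) + kappa) + \sum_y (excess (d' y) + kappa)).
Proof.
move=> k0 tauE hM.
pose p : 'cV[R]_m := \col_x Num.sqrt (excess (d x) + kappa).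
pose q : 'cV[R]_n := \col_y Num.sqrt (excess (d' y) + kappa).
have wk a : 0 < excess a + kappa by rewrite ltr_wpDl ?excess_ge0.
have p0 x : 0 < p x 0 by rewrite mxE sqrtr_gt0.
have q0 y : 0 < q y 0 by rewrite mxE sqrtr_gt0.
have p2 x : p x 0 ^+ 2 = excess (d x) + kappa by rewrite mxE sqr_sqrtr // ltW.
have q2 y : q y 0 ^+ 2 = excess (d' y) + kappa by rewrite mxE sqr_sqrtr // ltW.
clearbody p q.
(* The factor 2 accounts for the [2^-1] required by [l2_opnorm_le1]. *)
pose B := \matrix_(x, y) ((M x y - N x y) / (2 * p x 0 * q y 0)).
have bilin (C : 'M[R]_(m, n)) (s : 'cV[R]_m) (t : 'cV[R]_n) :
    (s^T *m C *m t) 0 0 = \sum_x \sum_y C x y * (s x 0 * t y 0).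
  rewrite mxE exchange_big; apply: eq_bigr => y _; rewrite mxE mulr_suml.
  by apply: eq_bigr => x _; rewrite mxE; ring.
have B1 : (l2_opnorm B <= 1%:E)%E.
  apply: l2_opnorm_le1 => s t; rewrite bilin.
  have := near_minimizer_bilinear (\col_x (s x 0 / p x 0)) (\col_y (t y 0 / q y 0)) k0 tauE.
  have -> : \sum_x (excess (d x) + kappa) * (\col_x0 (s x0 0 / p x0 0)) x 0 ^+ 2 =
      \sum_x s x 0 ^+ 2.
    by apply: eq_bigr => x _; rewrite -p2 [(\col_i _) x 0]mxE; field; rewrite gt_eqF.
  have -> : \sum_y (excess (d' y) + kappa) * (\col_x0 (t x0 0 / q x0 0)) y 0 ^+ 2 =
      \sum_y t y 0 ^+ 2.
    by apply: eq_bigr => y _; rewrite -q2 [(\col_i _) y 0]mxE; field; rewrite gt_eqF.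
  move=> h; rewrite -(@ler_pM2l _ 2) // mulrA mulfV // mul1r; apply: le_trans h.
  rewrite le_eqVlt; apply/orP; left; apply/eqP; rewrite mulr_sumr.
  apply: eq_bigr => x _; rewrite mulr_sumr; apply: eq_bigr => y _.
  rewrite [B x y]mxE [(\col_i _) x 0]mxE [(\col_i _) y 0]mxE; field.
  by rewrite !gt_eqF.
have opn : (l2_opnorm (map2_mx *%R M B) <= gamma%:E)%E.
  by apply: le_trans hM; apply: ereal_sup_ubound; exists B.
have := l2_opnorm_le opn q.
move=> h; have := l2_CauchySchwarz p (map2_mx *%R M B *m q).
have -> : (p^T *m (map2_mx *%R M B *m q)) 0 0 =
    2^-1 * \sum_x \sum_y M x y * (M x y - N x y).
  rewrite mulmxA bilin mulr_sumr; apply: eq_bigr => x _; rewrite mulr_sumr.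
  apply: eq_bigr => y _; rewrite [map2_mx _ _ _ _ _]mxE [B x y]mxE; field.
  by rewrite !gt_eqF.
have -> : \sum_x (excess (d x) + kappa) = l2norm p ^+ 2.
  by rewrite sqr_l2norm; apply: eq_bigr => x _; rewrite p2.
have -> : \sum_x (excess (d' x) + kappa) = l2norm q ^+ 2.
  by rewrite sqr_l2norm; apply: eq_bigr => x _; rewrite q2.
have := ler_wpM2l (l2norm_ge0 p) h.
(* The product of the norms of [p] and [q] is at most half the sum of their squares. *)
have := mulr_ge0 gamma0 (sqr_ge0 (l2norm p - l2norm q)).
lra.
Qed.

(** Write the squared distance as the pairing of [M - N] with [M] minus its pairing with [N]. The
    first is bounded by [gamma] times the total excess, up to [kappa]. In the scaling inequality
    [excess a * a] is [gamma * excess a + excess a ^+ 2], so the terms linear in the excess cancel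
    and only a multiple of [kappa] remains. *)
Lemma near_minimizer_defect (kappa : R) : 0 < kappa -> kappa <= 1 ->
  tau = kappa ^+ 2 -> (schur_norm M <= gamma%:E)%E ->
  defect N d d' <= kappa * (gamma * (m%:R + n%:R) + 2
    + \sum_x \sum_y M x y ^+ 2 + gamma ^+ 2 * (m%:R + n%:R)
    + defect 0 (fun=> 0) (fun=> 0)).
Proof.
move=> k0 k1 tauE hM.
have pair := near_minimizer_pairing k0 tauE hM.
have shrink := near_minimizer_shrink (ltW k0) k1.
have zero := minN factor_data0.
have [d0 d'0] := factor_data_ge0 dataN.
have addk p (f : 'I_p -> R) : \sum_x (excess (f x) + kappa) = \sum_x excess (f x) + kappa * p%:R.
  by rewrite big_split /= sumr_const card_ord mulr_natr.
have exM p (f : 'I_p -> R) : \sum_x 2 * (excess (f x) * f x) =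
    2 * (gamma * (\sum_x excess (f x)) + \sum_x excess (f x) ^+ 2).
  by rewrite mulr_sumr -big_split mulr_sumr; apply: eq_bigr => x _; rewrite excessM.
have sq p (f : 'I_p -> R) : (forall x, 0 <= f x) ->
    \sum_x f x ^+ 2 <= 2 * gamma ^+ 2 * p%:R + 2 * \sum_x excess (f x) ^+ 2.
  move=> f0; have -> : 2 * gamma ^+ 2 * p%:R = \sum_(x < p) 2 * gamma ^+ 2.
    by rewrite sumr_const card_ord mulr_natr.
  rewrite mulr_sumr -big_split /=.
  by apply: ler_sum => x _; apply: sqr_le_excess.
have Nsq : \sum_x \sum_y N x y ^+ 2 <=
    2 * (\sum_x \sum_y M x y ^+ 2) + 2 * \sum_x \sum_y (M x y - N x y) ^+ 2.
  rewrite !mulr_sumr -big_split; apply: ler_sum => x _.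
  rewrite !mulr_sumr -big_split; apply: ler_sum => y _ /=.
  by have := sqr_ge0 (2 * M x y - N x y); lra.
have split2 : \sum_x \sum_y (M x y - N x y) ^+ 2 =
    \sum_x \sum_y M x y * (M x y - N x y) - \sum_x \sum_y (M x y - N x y) * N x y.
  rewrite -sumrB; apply: eq_bigr => x _; rewrite -sumrB; apply: eq_bigr => y _; ring.
have pull : \sum_x \sum_y 2 * ((M x y - N x y) * N x y) =
    2 * \sum_x \sum_y (M x y - N x y) * N x y.
  by rewrite mulr_sumr; apply: eq_bigr => x _; rewrite mulr_sumr.
have sd := sq _ d d0; have sd' := sq _ d' d'0.
rewrite !addk in pair; rewrite !exM pull tauE in shrink.
have k2 : kappa ^+ 2 <= 1 by rewrite expr_le1 // ltW.
(* Comparison with the zero factorization bounds the second-order coefficient independently of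
   [N]. *)
have Y : \sum_x \sum_y N x y ^+ 2 + \sum_x d x ^+ 2 + \sum_y d' y ^+ 2 <=
    2 * \sum_x \sum_y M x y ^+ 2 + 2 * gamma ^+ 2 * (m%:R + n%:R)
    + 2 * (defect 0 (fun=> 0) (fun=> 0) + 1).
  by move: zero; rewrite tauE {1}/defect; lra.
move: shrink; set Z := _ + \sum_y d' y ^+ 2.
have -> : kappa ^+ 2 + kappa ^+ 2 * Z = kappa * (kappa + kappa * Z) by ring.
rewrite ler_pM2l // => shrink; have := ler_wpM2l (ltW k0) Y.
by rewrite -/Z /defect; lra.
Qed.
End NearMinimizer.

Lemma schur_norm_ge0 : (schur_norm M <= gamma%:E)%E -> 0 <= gamma.
Proof.
move=> hM; rewrite -lee_fin; apply: le_trans hM.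
apply: (@le_trans _ _ (l2_opnorm (map2_mx *%R M 0))).
  apply: ereal_sup_ubound; exists 0; last by rewrite mulmx0 -(scale0r 0) l2normZ // mul0r.
  by rewrite /= -(scale0r 0) l2normZ // mul0r.
apply: ereal_sup_ubound; exists 0 => //=.
apply: ge_ereal_sup => _ [t _ <-]; rewrite lee_fin mul0mx.
by rewrite -(scale0r 0) l2normZ // mul0r ler01.
Qed.

Lemma schur_norm_factor_data (e : R) : 0 < e -> (schur_norm M <= gamma%:E)%E ->
  exists N d d', factor_data N d d' /\
    [/\ forall x y, `|M x y - N x y| <= e, forall x, d x <= gamma + e &
        forall y, d' y <= gamma + e].
Proof.
move=> e0 hM; have gamma0 := schur_norm_ge0 hM.
pose C := gamma * (m%:R + n%:R) + 2
    + \sum_x \sum_y M x y ^+ 2 + gamma ^+ 2 * (m%:R + n%:R)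
    + defect 0 (fun=> 0) (fun=> 0).
have C0 : 0 < C.
  have S0 : 0 <= \sum_x \sum_y M x y ^+ 2.
    by apply: sumr_ge0 => x _; apply: sumr_ge0 => y _; apply: sqr_ge0.
  have a0 : 0 <= gamma * (m%:R + n%:R) by rewrite mulr_ge0 // addr_ge0.
  have b0 : 0 <= gamma ^+ 2 * (m%:R + n%:R) by rewrite mulr_ge0 ?sqr_ge0 // addr_ge0.
  by have := defect_ge0 0 (fun=> 0) (fun=> 0); rewrite /C; lra.
(* Makes the defect at most [e ^+ 2], so each entry error and each excess is at most [e]. *)
pose kappa := Num.min 1 (e ^+ 2 / C).
have k0 : 0 < kappa by rewrite lt_min ltr01 divr_gt0 // exprn_gt0.
have k1 : kappa <= 1 by rewrite ge_min lexx.
have kC : kappa * C <= e ^+ 2 by rewrite -ler_pdivlMr // ge_min lexx orbT.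
have [N [d [d' [fN minN]]]] := near_minimizer (exprn_gt0 2 k0).
have := near_minimizer_defect gamma0 fN minN k0 k1 erefl hM.
rewrite -/C => /le_trans /(_ kC) def_le.
have part1 : 0 <= \sum_x \sum_y (M x y - N x y) ^+ 2.
  by apply: sumr_ge0 => x _; apply: sumr_ge0 => y _; apply: sqr_ge0.
have part2 : 0 <= \sum_x excess (d x) ^+ 2 by apply: sumr_ge0 => x _; apply: sqr_ge0.
have part3 : 0 <= \sum_y excess (d' y) ^+ 2 by apply: sumr_ge0 => x _; apply: sqr_ge0.
have term (I : finType) (f : I -> R) i : (forall i, 0 <= f i) -> f i <= \sum_j f j.
  by move=> f0; rewrite (bigD1 i) //= lerDl sumr_ge0.
have small a : excess a ^+ 2 <= e ^+ 2 -> a <= gamma + e.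
  rewrite ler_pXn2r ?nnegrE ?excess_ge0 ?(ltW e0) // => h.
  have : a - gamma <= excess a by rewrite le_max lexx orbT.
  lra.
exists N, d, d'; split=> //; split=> [x y|x|y].
- rewrite -(@ler_pXn2r _ 2) ?nnegrE ?(ltW e0) // real_normK ?num_real //.
  apply: le_trans def_le; rewrite /defect.
  have := term _ (fun x => \sum_y (M x y - N x y) ^+ 2) x
    (fun x => sumr_ge0 _ (fun y _ => sqr_ge0 _)).
  have := term _ (fun y => (M x y - N x y) ^+ 2) y (fun y => sqr_ge0 _).
  lra.
- apply: small; apply: le_trans def_le; rewrite /defect.
  by have := term _ (fun x => excess (d x) ^+ 2) x (fun x => sqr_ge0 _); lra.
- apply: small; apply: le_trans def_le; rewrite /defect.
  by have := term _ (fun x => excess (d' x) ^+ 2) y (fun x => sqr_ge0 _); lra.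
Qed.

End Schur.

Lemma schur_norm_approx_factored (R : realType) m n (A : 'M[int]_(m, n)) (gamma e : R) :
  0 < e -> (schur_norm (int_to_real_mx R A) <= gamma%:E)%E ->
  exists (V : lmodType R) (dot : V -> V -> R),
    psd_form dot /\ approx_factored dot (gamma + e) (gamma + e) e A.
Proof.
move=> e0 hA.
have [N [d [d' [[k [F [H [-> hd hd']]]] [hN hdx hdy]]]]] := schur_norm_factor_data e0 hA.
have rowdot p r (G : 'M[R]_(p, k)) (G' : 'M[R]_(r, k)) x y :
    (row x G *m (row y G')^T) 0 0 = (G *m G'^T) x y.
  by rewrite !mxE; apply: eq_bigr => i _; rewrite !mxE.
exists 'rV[R]_k, (fun u v : 'rV[R]_k => (u *m v^T) 0 0); split.
  split.
  - by move=> u v; rewrite !mxE; apply: eq_bigr => i _; rewrite !mxE mulrC.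
  - by move=> u v w; rewrite mulmxDl mxE.
  - by move=> a u v; rewrite -scalemxAl mxE.
  - by move=> u; apply: gram_diag_ge0.
exists (fun x => row x F), (fun y => row y H); split.
- by move=> x; rewrite rowdot -hd.
- by move=> y; rewrite rowdot -hd'.
- by move=> x y; rewrite rowdot; have := hN x y; rewrite mxE.
Qed.

Theorem corollary1p5 (R : realType) :
  exists C : R, 0 < C /\
    (forall (m n : nat) (A : 'M[int]_(m, n)) (gamma : R),
       (gamma2 (int_to_real_mx R A) <= gamma%:E)%E ->
       exists L : nat,
         L%:R <= 2 `^ (C * gamma ^+ 4) /\ signed_blocky_sum A L) /\
    (forall (m n : nat) (A : 'M[int]_(m, n)) (gamma : R),
       boolean_mx A ->
       (schur_norm (int_to_real_mx R A) <= gamma%:E)%E ->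
       exists L : nat,
         L%:R <= 2 `^ (C * gamma ^+ 4) /\ signed_blocky_sum A L).
Proof.
(* The exponent [756 * g ^ 4] is combined with [g <= 4 * gamma]. *)
exists (756%:R * 4 ^+ 4); split.
  by apply: mulr_gt0; [rewrite ltr0n | rewrite exprn_gt0].
split=> m n A gamma => [hA|_ hA]; apply: approx_factored_signed_blocky_sum => e e0 nzA.
  exact: gamma2_approx_factored.
exact: schur_norm_approx_factored.
Qed.
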